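(* Let $\mathfrak{X}$ be an abstract state space, $(\mathcal{U}(t))_{t\ge0}$ a substochastic $C_0$-semigroup on $\mathfrak{X}$ with generator $\mathcal{A}$, $\mathcal{B}:\mathscr{D}(\mathcal{A})\to\mathfrak{X}$ a positive linear operator with $\langle\mathbf{\Psi},(\mathcal{A}+\mathcal{B})u\rangle\le0$ for all $u\in\mathscr{D}(\mathcal{A})\cap\mathfrak{X}_+$, and let $\mathcal{G}$ be the generator of the associated minimal semigroup $(\mathcal{V}(t))_{t\ge0}$. Let $\lambda>0$ and $u\in\mathfrak{X}_+$ be fixed. The following assertions are equivalent: (i) the set $\{[\mathcal{B}(\lambda-\mathcal{A})^{-1}]^nu\}_n$ is relatively weakly compact; (ii) $\lim_{n\to\infty}\|[\mathcal{B}(\lambda-\mathcal{A})^{-1}]^nu\|=0$; (iii) $\langle\mathbf{\Xi}_\lambda,u\rangle=0$; (iv) $(\lambda-\mathcal{G})^{-1}u\in\mathscr{D}(\overline{\mathcal{A}+\mathcal{B}})$.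
   Context: An abstract state space is a real ordered Banach space $\mathfrak{X}$ whose positive cone $\mathfrak{X}_+$ is closed, generating ($\mathfrak{X}=\mathfrak{X}_+-\mathfrak{X}_+$), and on which the norm is additive: $\|u+v\|=\|u\|+\|v\|$ for $u,v\in\mathfrak{X}_+$. $\mathbf{\Psi}\in\mathfrak{X}^\star_+$ is the positive functional with $\langle\mathbf{\Psi},u\rangle=\|u\|$ for $u\in\mathfrak{X}_+$. A linear operator is positive if it maps positive elements of its domain into $\mathfrak{X}_+$. A $C_0$-semigroup $(T(t))_{t\ge0}$ is substochastic if each $T(t)$ is positive and $\|T(t)u\|\le\|u\|$ for $u\in\mathfrak{X}_+$. Minimal semigroup: under the stated hypotheses there is a smallest (for the operator order, for each $t$) substochastic $C_0$-semigroup $(\mathcal{V}(t))_{t\ge0}$ whose generator $\mathcal{G}$ extends $(\mathcal{A}+\mathcal{B},\mathscr{D}(\mathcal{A}))$; it satisfies $(\lambda-\mathcal{G})^{-1}u=\lim_{n\to\infty}(\lambda-\mathcal{A})^{-1}\sum_{k=0}^n[\mathcal{B}(\lambda-\mathcal{A})^{-1}]^ku$ for all $\lambda>0$, $u\in\mathfrak{X}$. $\overline{\mathcal{A}+\mathcal{B}}$ is the closure of $(\mathcal{A}+\mathcal{B},\mathscr{D}(\mathcal{A}))$. Functionals: $\mathfrak{a}_0(u)=-\langle\mathbf{\Psi},\mathcal{G}u\rangle$ for $u\in\mathscr{D}(\mathcal{G})$; $\mathfrak{a}$ is its restriction to $\mathscr{D}(\mathcal{A})$, i.e. $\mathfrak{a}(u)=-\langle\mathbf{\Psi},\mathcal{A}u+\mathcal{B}u\rangle$;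 and $\overline{\mathfrak{a}}:\mathscr{D}(\mathcal{G})\to\mathbb{R}$ is the linear functional defined by $\overline{\mathfrak{a}}((\lambda-\mathcal{G})^{-1}u)=\sum_{n=0}^\infty\mathfrak{a}\big((\lambda-\mathcal{A})^{-1}[\mathcal{B}(\lambda-\mathcal{A})^{-1}]^nu\big)$, $u\in\mathfrak{X}$, where the series converges and the resulting functional does not depend on $\lambda>0$. For $\lambda>0$, $\mathbf{\Xi}_\lambda\in\mathfrak{X}^\star$ is defined by $\langle\mathbf{\Xi}_\lambda,u\rangle=\mathfrak{a}_0((\lambda-\mathcal{G})^{-1}u)-\overline{\mathfrak{a}}((\lambda-\mathcal{G})^{-1}u)$, $u\in\mathfrak{X}$. *)

(* Defs.v *)
From HB Require Import structures.
From mathcomp Require Import all_boot all_order all_algebra.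
From mathcomp Require Import all_classical all_reals all_analysis.

Set Implicit Arguments.
Unset Strict Implicit.
Unset Printing Implicit Defensive.

Import Order.TTheory GRing.Theory Num.Theory.
Import numFieldNormedType.Exports.

Local Open Scope classical_set_scope.
Local Open Scope ring_scope.

Section AbstractStateSpace.
Context {R : realType} {X : completeNormedModType R}.

(* [P] is the positive cone: u <= v means P (v - u). *)
Record abstract_state_space (P : set X) : Prop := AbstractStateSpace {
  cone_add : forall u v, P u -> P v -> P (u + v) ;
  cone_scale : forall (a : R) u, 0 <= a -> P u -> P (a *: u) ;
  cone_pointed : forall u, P u -> P (- u) -> u = 0 ;
  cone_closed : closed P ;
  cone_generating : forall u, exists v w, [/\ P v, P w & u = v - w] ;
  cone_norm_additive : forall u v, P u -> P v -> `|u + v| = `|u| + `|v|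
}.

(* Such a functional is unique, the cone being generating. *)
Record norm_functional (P : set X) (Psi : {linear X -> R^o}) : Prop :=
  NormFunctional {
  norm_functional_continuous : continuous Psi ;
  norm_functional_ge0 : forall u, P u -> (0 : R) <= Psi u ;
  norm_functionalE : forall u, P u -> Psi u = `|u|
}.

(* Only the values T t for 0 <= t are meaningful. *)
Record C0_semigroup (T : R -> X -> X) : Prop := C0Semigroup {
  C0_linear : forall t, 0 <= t -> linear (T t) ;
  C0_bounded : forall t, 0 <= t -> continuous (T t) ;
  C0_at0 : forall u, T 0 u = u ;
  C0_add : forall s t u, 0 <= s -> 0 <= t -> T (s + t) u = T s (T t u) ;
  C0_strongly_continuous : forall u, T t u @[t --> 0^'+] --> u
}.

Record substochastic (P : set X) (T : R -> X -> X) : Prop := Substochastic {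
  substochastic_C0 : C0_semigroup T ;
  substochastic_ge0 : forall t u, 0 <= t -> P u -> P (T t u) ;
  substochastic_le : forall t u, 0 <= t -> P u -> `|T t u| <= `|u|
}.

(* An unbounded operator is given by its domain, a set D, together with a total
   function X -> X of which only the values on D are meaningful. *)
Definition gen_dom (T : R -> X -> X) : set X :=
  [set u | cvg (t^-1 *: (T t u - u) @[t --> 0^'+])].

Definition gen (T : R -> X -> X) (u : X) : X :=
  lim (t^-1 *: (T t u - u) @[t --> 0^'+]).

Definition linear_on (D : set X) (B : X -> X) : Prop :=
  forall (a : R) u v, D u -> D v -> B (a *: u + v) = a *: B u + B v.

Definition positive_on (P D : set X) (B : X -> X) : Prop :=
  forall u, D u -> P u -> P (B u).

(* (lam - A)^-1 u. The default 0 and the choice play no role when lam is in the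
   resolvent set, as is every 0 < lam if A generates a substochastic semigroup:
   there is then exactly one such v. *)
Definition resolvent (D : set X) (A : X -> X) (lam : R) (u : X) : X :=
  xget 0 [set v | D v /\ lam *: v - A v = u].

Definition graph (D : set X) (A : X -> X) : set (X * X) :=
  [set (u, A u) | u in D].

Definition closure_dom (D : set X) (A : X -> X) : set X :=
  [set u | exists v, closure (graph D A) (u, v)].

Definition extends (D' : set X) (A' : X -> X) (D : set X) (A : X -> X) : Prop :=
  D `<=` D' /\ forall u, D u -> A' u = A u.

Definition perturbation (U : R -> X -> X) (B : X -> X) (u : X) : X :=
  gen U u + B u.

Definition substochastic_extension (P : set X) (U : R -> X -> X) (B : X -> X)
    (V : R -> X -> X) : Prop :=
  substochastic P V /\
  extends (gen_dom V) (gen V) (gen_dom U) (perturbation U B).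

Definition minimal_semigroup (P : set X) (U : R -> X -> X) (B : X -> X)
    (V : R -> X -> X) : Prop :=
  substochastic_extension P U B V /\
  forall W, substochastic_extension P U B W ->
    forall t u, 0 <= t -> P u -> P (W t u - V t u).

Section Functionals.
Variables (Psi : {linear X -> R^o}) (U : R -> X -> X) (B : X -> X)
  (V : R -> X -> X).

Definition resA (lam : R) : X -> X := resolvent (gen_dom U) (gen U) lam.
Definition resG (lam : R) : X -> X := resolvent (gen_dom V) (gen V) lam.

Definition BresA (lam : R) (u : X) : X := B (resA lam u).

Definition fun_a0 (u : X) : R := - Psi (gen V u).
Definition fun_a (u : X) : R := - Psi (perturbation U B u).

(* The value at v is the number which, for every 0 < lam and every u such that
   v = (lam - G)^-1 u, is the sum of the defining series. That the
   sum exists and does not depend on lam is a fact about the minimal semigroup;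
   only values at v in D(G) are meaningful. *)
Definition fun_abar (v : X) : R :=
  xget 0 [set s : R | forall (lam : R) (u : X), 0 < lam -> resG lam u = v ->
    series (fun n => fun_a (resA lam (iter n (BresA lam) u))) @ \oo --> s].

Definition Xi (lam : R) (u : X) : R :=
  fun_a0 (resG lam u) - fun_abar (resG lam u).

End Functionals.

End AbstractStateSpace.

Definition dual {R : realType} (X : completeNormedModType R) : Type :=
  {f : {linear X -> R^o} | continuous f}.

(* X with the coarsest topology making all its continuous functionals
   continuous. *)
Definition weak {R : realType} (X : completeNormedModType R) : topologicalType :=
  sup_topology (fun f : dual X =>
    Topological.class (initial_topology (sval f : X -> R^o))).

Definition relatively_weakly_compact {R : realType}
    {X : completeNormedModType R} (S : set X) : Prop :=
  @precompact (weak X) S.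

(* Main.v *)
(** Write [r] for the resolvent of the generator [A], [K := B r] at a fixed
    [lam], and [flux u := lim Psi (K^n u)], which for [u] in the cone is the limit
    of the norms of [K^n u]. Kato's series [sum_n r K^n] is a family of positive
    operators satisfying the resolvent identity; the semigroup it generates
    extends [A + B], so by minimality the series is the resolvent of [G].
    Telescoping [fun_a (r K^n u) = Psi (K^n u) - Psi (K^(n+1) u) - lam Psi (r K^n u)]
    then gives [Xi u = flux u].
    - If the orbit is relatively weakly compact and [z] is a weak cluster point,
      then [Psi (r_mu z) = 0] for every [mu], since [r K^n u] tends to 0; as
      [mu r_mu z] tends to [z], the limit [Psi z] of the norms is 0.
    - If [K^n u] tends to 0, the partial sums of Kato's series approximate
      [(lam - G)^-1 u] in the graph norm of [A + B].
    - Conversely [flux] is continuous and vanishes on the range of [I - K], which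
      is that of [lam - A - B]; if [(lam - G)^-1 u] lies in the domain of the
      closure of [A + B] then [u] is a limit of elements of this range.
    The resolvent of a semigroup is the limit of the dyadic Riemann sums of its
    Laplace transform, and the semigroup with a given resolvent family is the
    limit of the dyadic implicit Euler schemes. *)
Require Import Defs.
From HB Require Import structures.
From mathcomp Require Import all_boot all_order all_algebra.
From mathcomp Require Import all_classical all_reals all_analysis.
From mathcomp Require Import ring lra.
Import Order.TTheory GRing.Theory Num.Theory.
Import numFieldNormedType.Exports.
Local Open Scope classical_set_scope.
Local Open Scope ring_scope.

Set Implicit Arguments.
Unset Strict Implicit.
Unset Printing Implicit Defensive.

(** * Linear combinations, linear maps, sequences *)

(* The tactic [module] decides equalities of linear combinations in a module,
   reducing them to the equality of the coefficients, which is left to [ring]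
   and [field]. *)
Inductive lin_expr (R : Type) :=
  | LVar of nat
  | LZero
  | LAdd of lin_expr R & lin_expr R
  | LOpp of lin_expr R
  | LScale of R & lin_expr R.

Section LinExpr.
Context {R : comNzRingType} {X : lmodType R}.

Fixpoint lin_eval (env : seq X) (e : lin_expr R) : X :=
  match e with
  | LVar n => nth 0 env n
  | LZero => 0
  | LAdd a b => lin_eval env a + lin_eval env b
  | LOpp a => - lin_eval env a
  | LScale c a => c *: lin_eval env a
  end.

Fixpoint lin_coef (i : nat) (e : lin_expr R) : R :=
  match e with
  | LVar n => if eqn n i then 1 else 0
  | LZero => 0
  | LAdd a b => lin_coef i a + lin_coef i b
  | LOpp a => - lin_coef i a
  | LScale c a => c * lin_coef i a
  end.

Lemma lin_evalE env e :
  lin_eval env e = \sum_(i < size env) lin_coef i e *: env`_i.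
Proof.
elim: e => [n||a IHa b IHb|a IHa|c a IHa] /=.
- have [nlt|nge] := ltnP n (size env); last first.
    rewrite nth_default// big1// => i _; case: eqnP => [ni|]; last by rewrite scale0r.
    by move: (ltn_ord i); rewrite -ni ltnNge nge.
  rewrite (bigD1 (Ordinal nlt))//= big1 ?addr0; last first.
    move=> i /eqP ni; case: eqnP => [e|]; last by rewrite scale0r.
    by case: ni; apply: val_inj.
  by case: eqnP => // _; rewrite scale1r.
- by rewrite big1// => i _; rewrite scale0r.
- by rewrite IHa IHb -big_split; apply: eq_bigr => i _; rewrite scalerDl.
- by rewrite IHa -sumrN; apply: eq_bigr => i _; rewrite scaleNr.
- by rewrite IHa scaler_sumr; apply: eq_bigr => i _; rewrite scalerA.
Qed.

(** A recursive conjunction instead of a quantified statement: it computes to one scalar equation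
    per variable, ready for [ring] and [field]. *)
Fixpoint lin_eqs (n : nat) (e f : lin_expr R) : Prop :=
  if n is n'.+1 then lin_coef n' e = lin_coef n' f /\ lin_eqs n' e f else True.

Lemma lin_eval_eq env e f : lin_eqs (size env) e f ->
  lin_eval env e = lin_eval env f.
Proof.
move=> h; rewrite !lin_evalE; apply: eq_bigr => i _; congr (_ *: _).
elim: (size env) i h => [[]//|n IH] i /= [h hs].
have [e0|ni] := eqVneq (val i) n; first by rewrite /= in e0 *; rewrite e0.
have lin : (i < n)%N by rewrite ltn_neqAle ni -ltnS ltn_ord.
exact: (IH (Ordinal lin)).
Qed.

End LinExpr.

Ltac lin_mem x env :=
  lazymatch env with
  | nil => constr:(false)
  | x :: _ => constr:(true)
  | _ :: ?l => lin_mem x l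
  end.

Ltac lin_index x env :=
  lazymatch env with
  | x :: _ => constr:(0%N)
  | _ :: ?l => let n := lin_index x l in constr:(S n)
  end.

Ltac lin_vars t env :=
  lazymatch t with
  | @GRing.add _ ?a ?b => let env := lin_vars a env in lin_vars b env
  | @GRing.opp _ ?a => lin_vars a env
  | @GRing.zero _ => env
  | @GRing.scale _ _ ?c ?a => lin_vars a env
  | _ => let b := lin_mem t env in
         lazymatch b with true => env | false => constr:(t :: env) end
  end.

Ltac lin_reify K t env :=
  lazymatch t with
  | @GRing.add _ ?a ?b =>
      let a := lin_reify K a env in let b := lin_reify K b env in
      constr:(@LAdd K a b)
  | @GRing.opp _ ?a => let a := lin_reify K a env in constr:(@LOpp K a)
  | @GRing.zero _ => constr:(@LZero K)
  | @GRing.scale _ _ ?c ?a =>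
      let a := lin_reify K a env in constr:(@LScale K c a)
  | _ => let n := lin_index t env in constr:(@LVar K n)
  end.

Ltac module_in K :=
  lazymatch goal with
  | |- @eq ?T ?a ?b =>
      let env := lin_vars a (@nil T) in
      let env := lin_vars b env in
      let ea := lin_reify K a env in
      let eb := lin_reify K b env in
      refine (@lin_eval_eq K _ env ea eb _);
      cbn [lin_eqs lin_coef size eqn]; repeat split
  end.

Ltac module :=
  lazymatch goal with
  | R : realType |- _ => module_in (Real.sort R)
  end; try ring; try field.

Section LinearMaps.
Context {R : realType} {X : lmodType R} {K : X -> X} (hK : linear K).

Let pack : {linear X -> X} := HB.pack K (GRing.isLinear.Build _ _ _ _ _ hK).

Lemma lin0 : K 0 = 0. Proof. exact: (linear0 pack). Qed.
Lemma linD x y : K (x + y) = K x + K y. Proof. exact: (linearD pack). Qed.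
Lemma linB x y : K (x - y) = K x - K y. Proof. exact: (linearB pack). Qed.
Lemma linZ a x : K (a *: x) = a *: K x. Proof. exact: (linearZ_LR pack). Qed.
Lemma lin_sum (I : Type) (r : seq I) (Q : pred I) (E : I -> X) :
  K (\sum_(i <- r | Q i) E i) = \sum_(i <- r | Q i) K (E i).
Proof. exact: (linear_sum pack). Qed.

Lemma linear_iter n : linear (iter n K).
Proof. by elim: n => [|n IH] a x y //=; rewrite IH hK. Qed.

End LinearMaps.

Section Sequences.
Context {R : realType} {X : completeNormedModType R}.
Implicit Types x y : X ^nat.

Lemma cvgn_distP {V : normedModType R} (x : V ^nat) (l : V) :
  x @ \oo --> l <->
  forall e : R, 0 < e -> exists N, forall n, (N <= n)%N -> `|x n - l| <= e.
Proof.
split=> [/cvgrPdistC_le h e /h [N _ hN]|h]; first by exists N => n /hN.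
by apply/cvgrPdistC_le => e /h [N hN]; exists N => // n /hN.
Qed.

Lemma cvgn_unique {V : normedModType R} (x : V ^nat) (a b : V) :
  x @ \oo --> a -> x @ \oo --> b -> a = b.
Proof. by apply: cvg_unique; exact: norm_hausdorff. Qed.

Lemma eq_cvgn {V : normedModType R} (x y : V ^nat) (a : V) :
  (forall n, y n = x n) -> x @ \oo --> a -> y @ \oo --> a.
Proof. by move=> /funext ->. Qed.

Lemma cvgnD {V : normedModType R} (x y : V ^nat) (a b : V) :
  x @ \oo --> a -> y @ \oo --> b -> (fun n => x n + y n) @ \oo --> a + b.
Proof. exact: cvgD. Qed.

Lemma cvgnB {V : normedModType R} (x y : V ^nat) (a b : V) :
  x @ \oo --> a -> y @ \oo --> b -> (fun n => x n - y n) @ \oo --> a - b.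
Proof. exact: cvgB. Qed.

Lemma cauchy_tail_cvg x :
  (forall e : R, 0 < e -> exists N, forall n, (N <= n)%N -> `|x n - x N| <= e) ->
  cvgn x.
Proof.
move=> h; apply/cauchy_cvgP/cauchyP => e e0.
have /h[N hN] : 0 < e / 2 by rewrite divr_gt0.
exists (x N); exists N => // n /= /hN.
rewrite -ball_normE /= distrC => /le_lt_trans; apply.
by rewrite ltr_pdivrMr// ltr_pMr// ltr1n.
Qed.

Lemma cvg_half_pow (c : R) : (fun n => c * 2^-1 ^+ n) @ \oo --> (0 : R).
Proof. by apply: cvg_geometric; rewrite ger0_norm// invf_lt1// ltr1n. Qed.

Lemma half_pow_small (c e : R) : 0 < e ->
  exists N, forall n, (N <= n)%N -> c * 2^-1 ^+ n <= e.
Proof.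
move=> e0; have /cvgn_distP/(_ e e0)[N hN] := cvg_half_pow c.
by exists N => n /hN; rewrite subr0; apply: le_trans; apply: ler_norm.
Qed.

Lemma cvg_geometric_rate x C : (forall n, `|x n.+1 - x n| <= C * 2^-1 ^+ n) ->
  cvgn x.
Proof.
move=> h.
(* The factor [1 - 2^-1 ^+ m] is that of a finite geometric sum; with the cruder bound
   [2 * C * 2^-1 ^+ n] the induction on [m] would not close. *)
have tail n m : `|x (n + m)%N - x n| <= 2 * C * 2^-1 ^+ n * (1 - 2^-1 ^+ m).
  elim: m => [|m IH]; first by rewrite addn0 expr0 !subrr normr0 mulr0.
  rewrite addnS -(subrKA (x (n + m)%N)) (le_trans (ler_normD _ _))//.
  apply: le_trans (lerD (h _) IH) _.
  by rewrite exprD exprS; set a := _ ^+ n; set b := _ ^+ m; lra.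
have C0 : 0 <= C by have := h 0%N; rewrite expr0 mulr1; apply: le_trans.
apply: cauchy_tail_cvg => e /(half_pow_small (2 * C))[N hN]; exists N => n Nn.
rewrite -(subnKC Nn) (le_trans (tail _ _))// (le_trans _ (hN _ (leqnn N)))//.
rewrite ler_piMr// ?mulr_ge0 ?exprn_ge0 ?invr_ge0//.
Qed.

Lemma cvgn_norm_le {V : normedModType R} (x : V ^nat) (l : V) (c : R) :
  x @ \oo --> l -> (forall n, `|x n| <= c) -> `|l| <= c.
Proof.
move=> xl xc; apply: (ler_cvg_to (cvg_norm xl) (cvg_cst c)).
by apply: nearW => n; exact: xc.
Qed.

End Sequences.

(** * Positive operators *)

Section Cone.
Context {R : realType} {X : completeNormedModType R} {P : set X}.
Hypothesis hX : abstract_state_space P.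

Lemma cone0 : P 0.
Proof.
have [p [q [Pp _ _]]] := cone_generating hX 0.
by rewrite -(scale0r p); exact: cone_scale.
Qed.

Lemma cone_sum (I : Type) (r : seq I) (Q : pred I) (E : I -> X) :
  (forall i, Q i -> P (E i)) -> P (\sum_(i <- r | Q i) E i).
Proof. by move=> h; elim/big_ind: _ => //; [exact: cone0|exact: cone_add]. Qed.

Lemma cone_cvg (x : X ^nat) l : x @ \oo --> l -> (forall n, P (x n)) -> P l.
Proof.
move=> xl Px; apply: (closed_cvg P (cone_closed hX) _ _ xl).
exact: nearW.
Qed.

Lemma cone_cvgB (x y : X ^nat) a b : x @ \oo --> a -> y @ \oo --> b ->
  (forall n, P (x n - y n)) -> P (a - b).
Proof. by move=> xa yb h; exact: (cone_cvg (cvgB xa yb)). Qed.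

Lemma cone_norm_le p q : P p -> P (q - p) -> `|p| <= `|q|.
Proof.
by move=> Pp Pqp; rewrite -(subrK p q) (cone_norm_additive hX)// lerDr.
Qed.

Lemma cone_norm_sum (x : X ^nat) n : (forall k, P (x k)) ->
  `|\sum_(0 <= k < n) x k| = \sum_(0 <= k < n) `|x k|.
Proof.
move=> Px; elim: n => [|n IH]; first by rewrite !big_nil normr0.
rewrite !big_nat_recr//= -IH (cone_norm_additive hX)//.
by apply: cone_sum => i _.
Qed.

Lemma cone_series_cvg (x : X ^nat) (C : R) : (forall k, P (x k)) ->
  (forall n, \sum_(0 <= k < n) `|x k| <= C) -> cvgn (series x).
Proof.
move=> Px xC; apply: normed_cvg; apply: nondecreasing_is_cvgn.
  by apply/nondecreasing_seqP => n; rewrite [leRHS]big_nat_recr//= lerDl.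
by exists C => _ [n _ <-]; exact: xC.
Qed.

(* Baire's theorem only provides a decomposition up to a small error. *)
Lemma almost_generating : exists2 C : R, 0 <= C & forall x, exists p q,
  [/\ P p, P q, `|x - (p - q)| <= `|x| / 2, `|p| <= C * `|x| & `|q| <= C * `|x|].
Proof.
pose S n := [set x : X | exists p q,
  [/\ P p, P q, x = p - q, `|p| <= n%:R & `|q| <= n%:R]].
(* The sets [S n] cover [X] because the cone is generating, so by Baire the complements of their
   closures cannot all be dense. *)
have [n nd] : exists n, ~ dense (~` closure (S n)).
  apply: contrapT => /forallNP nd.
  have dF n : dense (~` closure (S n)) by apply: contrapT; exact: nd.
  have /Baire/(_ setT) : forall n, open (~` closure (S n)) /\ dense (~` closure (S n)).
    by move=> n; split => //; apply: closed_openC; exact: closed_closure.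
  case; [by exists 0|exact: openT|].
  move=> x [_ hx]; have [p [q [Pp Pq xpq]]] := cone_generating hX x.
  pose m := (Num.truncn (`|p| + `|q|)).+1.
  apply: (hx m I); apply: subset_closure; exists p, q; split=> //.
  - by rewrite (le_trans _ (ltW (truncnS_gt _)))// lerDl.
  - by rewrite (le_trans _ (ltW (truncnS_gt _)))// lerDr.
have [D [[a Da] oD DS]] : exists D, [/\ D !=set0, open D & D `<=` closure (S n)].
  apply: contrapT => /forallNP hD; apply: nd => D D0 oD.
  apply/set0P/negP => /eqP DS; apply: (hD D); split=> //.
  by move=> x Dx; apply: contrapT => nx; have : (D `&` ~` closure (S n)) x by []; rewrite DS.
have /nbhs_ballP[r /= r0 rD] : nbhs a D by exact: open_nbhs_nbhs.
have near y e : closure (S n) y -> 0 < e -> exists2 s, S n s & `|y - s| <= e.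
  move=> cy e0; have [s [Ss]] := cy _ (nbhsx_ballx y e e0).
  by rewrite -ball_normE /= => /ltW; exists s.
exists ((n%:R + n%:R) / (r / 2)); first by rewrite divr_ge0 ?addr_ge0// divr_ge0// ltW.
move=> x; have [->|x0] := eqVneq x 0.
  by exists 0, 0; split; rewrite ?subrr ?normr0 ?mul0r ?mulr0//; exact: cone0.
have nx0 : 0 < `|x| by rewrite normr_gt0.
(* The multiple [c *: x] has norm [r / 2], so it is the difference of the two points [a + c *: x]
   and [a] of the ball, each approximated within [r / 8] by [S n]. Dividing by [c] turns the total
   error [r / 4] into half the norm of [x]. *)
pose c := (r / 2) / `|x|; have c0 : 0 < c by rewrite !divr_gt0.
have Dac : D (a + c *: x).
  apply: rD; rewrite -ball_normE /= opprD addrA subrr sub0r normrN normrZ.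
  by rewrite gtr0_norm// divfK ?gt_eqF// ltr_pdivrMr// ltr_pMr// ltr1n.
have r8 : 0 < r / 8 by rewrite divr_gt0.
have [_ [p1 [q1 [Pp1 Pq1 -> np1 nq1]]] h1] := near _ _ (DS _ Dac) r8.
have [_ [p2 [q2 [Pp2 Pq2 -> np2 nq2]]] h2] := near _ _ (DS _ Da) r8.
have bound y z : `|y| <= n%:R -> `|z| <= n%:R ->
    `|c^-1 *: (y + z)| <= (n%:R + n%:R) / (r / 2) * `|x|.
  move=> yn zn; rewrite normrZ gtr0_norm ?invr_gt0// invf_div [leRHS]mulrAC.
  rewrite -[leRHS]mulrA [leRHS]mulrC ler_wpM2l ?divr_ge0 ?(ltW r0)//.
  by rewrite (le_trans (ler_normD _ _))// lerD.
exists (c^-1 *: (p1 + q2)), (c^-1 *: (q1 + p2)); split.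
- by apply: cone_scale => //; [rewrite invr_ge0 ltW|exact: cone_add].
- by apply: cone_scale => //; [rewrite invr_ge0 ltW|exact: cone_add].
- have cN0 : c != 0 by rewrite gt_eqF.
  have -> : x - (c^-1 *: (p1 + q2) - c^-1 *: (q1 + p2)) =
      c^-1 *: (a + c *: x - (p1 - q1) - (a - (p2 - q2))).
    by module.
  rewrite normrZ gtr0_norm ?invr_gt0// invf_div.
  apply: (@le_trans _ _ (`|x| / (r / 2) * (r / 8 + r / 8))).
    rewrite ler_wpM2l ?divr_ge0 ?(ltW r0)//.
    by rewrite (le_trans (ler_normB _ _))// lerD.
  by rewrite le_eqVlt; apply/orP; left; apply/eqP; field; rewrite gt_eqF.
- exact: bound.
- exact: bound.
Qed.

(** Apply the approximate decomposition again and again to the remainder: the remainders halve,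
    hence both series of cone parts converge. *)
Lemma generating_const : exists2 M : R, 0 < M & forall x, exists p q,
  [/\ P p, P q, x = p - q & `|p| + `|q| <= M * `|x|].
Proof.
have [C C0 /choice[f /choice[g fg]]] := almost_generating.
(* Each of the two sums has norm at most [2 * C] times that of [x]; the additional 1 only makes the
   constant positive. *)
exists (4 * C + 1) => [|x]; first by rewrite ltr_wpDl// mulr_ge0.
pose y n := iter n (fun z => z - (f z - g z)) x.
have yS n : y n.+1 = y n - (f (y n) - g (y n)) by [].
have ny n : `|y n| <= `|x| * 2^-1 ^+ n.
  elim: n => [|n IH]; first by rewrite expr0 mulr1.
  have [_ _ + _ _] := fg (y n); rewrite -yS exprS => /le_trans; apply.
  by rewrite mulrCA mulrC ler_wpM2l// invr_ge0.
have sum (h : X -> X) : (forall z, P (h z)) -> (forall z, `|h z| <= C * `|z|) ->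
    exists2 p, series (h \o y) @ \oo --> p & P p /\ `|p| <= 2 * C * `|x|.
  move=> Ph hC.
  have sumC n : \sum_(0 <= k < n) `|h (y k)| <= 2 * C * `|x|.
    apply: (@le_trans _ _ (2 * C * `|x| * (1 - 2^-1 ^+ n))); last first.
      by rewrite ler_piMr ?mulr_ge0// gerBl exprn_ge0// invr_ge0.
    elim: n => [|n IH]; first by rewrite big_nil expr0 subrr mulr0.
    rewrite big_nat_recr//= (le_trans (lerD IH (hC _)))//.
    have := ler_wpM2l C0 (ny n); rewrite exprS; set a := 2^-1 ^+ n.
    by set b := `|y n|; set c := `|x|; lra.
  have /cvg_ex[p hp] : cvgn (series (h \o y)).
    by apply: cone_series_cvg => [k|n]; [exact: Ph|exact: sumC].
  exists p; first exact: hp.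
  split; first by apply: (cone_cvg hp) => n; apply: cone_sum => i _; exact: Ph.
  apply: cvgn_norm_le hp _ => n; rewrite (le_trans (ler_norm_sum _ _ _))//.
have [p hp [Pp np]] : exists2 p, series (f \o y) @ \oo --> p & P p /\ `|p| <= 2 * C * `|x|.
  by apply: sum => z; have [] := fg z.
have [q hq [Pq nq]] : exists2 p, series (g \o y) @ \oo --> p & P p /\ `|p| <= 2 * C * `|x|.
  by apply: sum => z; have [] := fg z.
exists p, q; split => //; last first.
  rewrite (le_trans (lerD np nq))//.
  have : 0 <= `|x| by [].
  by set a := `|x|; lra.
have /cvg_unique : y n @[n --> \oo] --> x - (p - q).
  have -> : y = fun n => x - (series (f \o y) n - series (g \o y) n).
    apply/funext; elim=> [|n IH].
      by rewrite !seriesEnat /= !big_nil subrr subr0.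
    by rewrite yS {1}IH !seriesSr /=; module.
  by apply: cvgB; [exact: cvg_cst|exact: cvgB].
move=> /(_ (@norm_hausdorff _ X) 0) h.
apply/eqP; rewrite -subr_eq0; apply/eqP; apply: h.
apply/cvgn_distP => e /(half_pow_small `|x|)[N hN]; exists N => n /hN.
by rewrite subr0; apply: le_trans.
Qed.

(** The bound is asked on the cone only, where constants multiply exactly under composition and pass
    to limits. *)
Definition pos_op (C : R) (K : X -> X) : Prop :=
  [/\ linear K, (forall p, P p -> P (K p)) &
      (forall p, P p -> `|K p| <= C * `|p|)].

(** The factor [M] comes from decomposing vectors along the cone and is the same for all operators,
    so that all powers of a contraction of the cone are uniformly bounded on [X]. *)
Lemma pos_op_bounded : exists2 M : R, 0 < M &
  forall (C : R) K, 0 <= C -> pos_op C K -> forall x, `|K x| <= M * C * `|x|.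
Proof.
have [M M0 hM] := generating_const; exists M => // C K C0 [Kl _ KC] x.
have [p [q [Pp Pq xpq npq]]] := hM x.
rewrite {1}xpq (linB Kl) (le_trans (ler_normB _ _))//.
rewrite (le_trans (lerD (KC _ Pp) (KC _ Pq)))// -mulrDr.
by rewrite mulrAC mulrC ler_wpM2r.
Qed.

Lemma pos_op_id : pos_op 1 id.
Proof. by split=> [a x y| |p Pp] //; rewrite mul1r. Qed.

Lemma pos_op_comp C D K L : 0 <= C -> pos_op C K -> pos_op D L ->
  pos_op (C * D) (K \o L).
Proof.
move=> C0 [Kl KP KC] [Ll LP LC]; split=> [a x y|p Pp|p Pp] /=.
- by rewrite Ll Kl.
- exact/KP/LP.
- by rewrite (le_trans (KC _ (LP _ Pp)))// -mulrA ler_wpM2l// LC.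
Qed.

Lemma pos_op_iter K n : pos_op 1 K -> pos_op 1 (iter n K).
Proof.
move=> hK; elim: n => [|n IH]; first exact: pos_op_id.
by rewrite -[1]mulr1; exact: (pos_op_comp ler01 hK IH).
Qed.

Lemma pos_op_scale C a K : 0 <= a -> pos_op C K ->
  pos_op (a * C) (fun x => a *: K x).
Proof.
move=> a0 [Kl KP KC]; split=> [b x y|p Pp|p Pp].
- by rewrite Kl; module.
- by apply: cone_scale => //; exact: KP.
- by rewrite normrZ ger0_norm// -mulrA ler_wpM2l// KC.
Qed.

Lemma pos_op_continuous C K : pos_op C K -> continuous K.
Proof.
move=> [Kl KP KC] x; have [M M0 hM] := pos_op_bounded.
have hK : pos_op `|C| K.
  by split=> // p Pp; rewrite (le_trans (KC _ Pp))// ler_wpM2r// ler_norm.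
apply/cvgrPdistC_le => e e0; apply/nbhs_ballP.
have MC : 0 < M * `|C| + 1 by rewrite ltr_wpDl// mulr_ge0// ltW.
exists (e / (M * `|C| + 1)) => [|y]; first exact: divr_gt0.
rewrite -ball_normE /= distrC => /ltW yx; rewrite -(linB Kl).
rewrite (le_trans (hM _ _ (normr_ge0 C) hK _))//.
apply: (@le_trans _ _ ((M * `|C| + 1) * `|y - x|)).
  by rewrite ler_wpM2r// lerDl.
by rewrite mulrC -ler_pdivlMr.
Qed.

Lemma pos_op_cvg C K x (y : X ^nat) : pos_op C K -> y @ \oo --> x ->
  K \o y @ \oo --> K x.
Proof. by move=> /pos_op_continuous hK yx; exact: (cvg_comp _ _ yx (hK x)). Qed.

Lemma pos_op_limit (C : R) (c : R ^nat) (Kn : nat -> X -> X) (K : X -> X) :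
  (forall n, pos_op (c n) (Kn n)) -> c @ \oo --> C ->
  (forall x, (fun n => Kn n x) @ \oo --> K x) -> pos_op C K.
Proof.
move=> hKn cC KnK; split=> [a x y|p Pp|p Pp].
- apply: (cvgn_unique (KnK (a *: x + y))).
  have -> : (fun n => Kn n (a *: x + y)) = fun n => a *: Kn n x + Kn n y.
    by apply/funext => n; case: (hKn n) => ->.
  by apply: cvgD => //; exact: cvgZr.
- by apply: (cone_cvg (KnK p)) => n; case: (hKn n) => _ + _; apply.
- apply: (ler_cvg_to (cvg_norm (KnK p)) (cvgMl cC)).
  by apply: nearW => n; case: (hKn n) => _ _; apply.
Qed.

(* The partial sums on the cone are increasing, hence absolutely convergent by
   additivity of the norm. *)
Lemma pos_op_series (C : R) (Kn : nat -> X -> X) :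
  (forall n, linear (Kn n)) -> (forall n p, P p -> P (Kn n p)) ->
  (forall n p, P p -> \sum_(0 <= k < n) `|Kn k p| <= C * `|p|) ->
  exists2 K, pos_op C K & forall x, series (fun n => Kn n x) @ \oo --> K x.
Proof.
move=> Knl KnP KnC.
have cv x : cvgn (series (fun n => Kn n x)).
  have [p [q [Pp Pq ->]]] := cone_generating hX x.
  have -> : series (fun n => Kn n (p - q)) =
      series (fun n => Kn n p) - series (fun n => Kn n q).
    apply/funext => n; rewrite /= !fctE -sumrB.
    by apply: eq_bigr => i _; rewrite (linB (Knl i)).
  have cone_cv y : P y -> cvgn (series (fun n => Kn n y)).
    by move=> Py; apply: cone_series_cvg => *; [exact: KnP|exact: KnC].
  by apply: is_cvgB; exact: cone_cv.
exists (fun x => limn (series (fun n => Kn n x))); last by move=> x; exact: cv.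
apply: (@pos_op_limit C (fun=> C) (fun n x => series (fun k => Kn k x) n)).
- move=> n; split=> [a x y|p Pp|p Pp] /=.
  + by rewrite scaler_sumr -big_split; apply: eq_bigr => i _; rewrite Knl.
  + by apply: cone_sum => i _; exact: KnP.
  + by rewrite (le_trans (ler_norm_sum _ _ _))// KnC.
- exact: cvg_cst.
- by move=> x; exact: cv.
Qed.

End Cone.

Arguments pos_op {R X} P C K.

(** * Right limits at 0 and the exponential function *)

Section RightLimits.
Context {R : realType} {V : normedModType R}.

Lemma cvg_right0P (f : R -> V) (l : V) :
  f t @[t --> 0^'+] --> l <->
  forall e : R, 0 < e -> exists2 d : R, 0 < d & forall t : R, 0 < t < d -> `|f t - l| <= e.
Proof.
split=> [/cvgrPdistC_le h e /h|h].
  move=> /nbhs_ballP[d /= d0 hd]; exists d => // t /andP[t0 td].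
  by apply: hd => //; rewrite -ball_normE /= sub0r normrN gtr0_norm.
apply/cvgrPdistC_le => e /h [d d0 hd]; apply/nbhs_ballP; exists d => // t.
rewrite -ball_normE /= sub0r normrN => td t0; apply: hd.
by rewrite t0 (le_lt_trans (ler_norm _) td).
Qed.

End RightLimits.

Section Exponential.
Context {R : realType}.

Lemma expR_right0 (c : R) : expR (c * t) @[t --> 0^'+] --> (1 : R).
Proof.
apply: cvg_at_right_filter; rewrite -(@expR0 R) -{2}(mulr0 c).
apply: (@continuous_comp _ _ _ (fun t => c * t) expR); last exact: continuous_expR.
exact: mulrl_continuous.
Qed.

Lemma expR_deriv_right0 (c : R) : t^-1 * (expR (c * t) - 1) @[t --> 0^'+] --> c.
Proof.
have h : is_derive (0 : R) 1 (fun t => expR (c * t)) c.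
  apply: is_derive_eq; rewrite mulr0 expR0; rewrite /GRing.scale /=; ring.
have := @ex_derive _ _ _ _ _ _ _ h.
rewrite /derivable => /cvg_ex[l hl].
have : 'D_1 (fun t => expR (c * t)) 0 = c by exact: derive_val.
rewrite /derive (cvg_lim _ hl)// => lc; rewrite lc in hl.
have : h0^-1 * (expR (c * h0) - 1) @[h0 --> 0^'] --> c.
  apply: cvg_trans hl; apply: near_eq_cvg; near=> t.
  by rewrite /= /GRing.scale /= mulr1 addr0 mulr0 expR0.
exact: cvg_dnbhs_at_right.
Unshelve. all: by end_near. Qed.

End Exponential.

(** * The resolvent of a substochastic semigroup *)

(* For a substochastic semigroup [T] and [0 < lam], [riemann h x] is the Riemann
   sum of step [h] of the Laplace transform of [t |-> T t x]. *)
Section Resolvent.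
Context {R : realType} {X : completeNormedModType R} {P : set X}.
Context {T : R -> X -> X} {lam : R}.
Hypotheses (hX : abstract_state_space P) (hT : substochastic P T).
Hypothesis lam0 : 0 < lam.

Let hC0 : C0_semigroup T := substochastic_C0 hT.

(** The rescaled semigroup, whose generator is that of [T] minus [lam]; integrating it over the
    half-line gives the resolvent at [lam]. *)
Definition damped t x := expR (- lam * t) *: T t x.
Local Notation S := damped.

Lemma pos_op_semigroup (t : R) : 0 <= t -> pos_op P 1 (T t).
Proof.
move=> t0; split; [exact: (C0_linear hC0)|by move=> p; apply: (substochastic_ge0 hT)|].
by move=> p Pp; rewrite mul1r (substochastic_le hT).
Qed.

Lemma pos_op_damped (t : R) : 0 <= t -> pos_op P (expR (- lam * t)) (S t).
Proof.
move=> t0; rewrite -[X in pos_op _ X]mulr1.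
exact: (pos_op_scale hX (expR_ge0 _) (pos_op_semigroup t0)).
Qed.

Lemma damped_linear (t : R) : 0 <= t -> linear (S t).
Proof. by move=> /pos_op_damped[]. Qed.

Lemma pos_op_damped1 (t : R) : 0 <= t -> pos_op P 1 (S t).
Proof.
move=> t0; have [Sl SP SC] := pos_op_damped t0; split=> // p Pp.
rewrite (le_trans (SC _ Pp))// ler_wpM2r// expR_le1.
by rewrite mulNr oppr_le0 mulr_ge0// ltW.
Qed.

Lemma damped0 x : S 0 x = x.
Proof. by rewrite /damped mulr0 expR0 scale1r C0_at0. Qed.

Lemma dampedD (s t : R) x : 0 <= s -> 0 <= t -> S (s + t) x = S s (S t x).
Proof.
move=> s0 t0; rewrite /damped mulrDr expRD (linZ (C0_linear hC0 s0)).
by rewrite scalerA C0_add.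
Qed.

Lemma damped_right0 x (e : R) : 0 < e ->
  exists2 d : R, 0 < d & forall t : R, 0 <= t < d -> `|S t x - x| <= e.
Proof.
have h : S t x @[t --> 0^'+] --> 1 *: x.
  by apply: cvgZ; [exact: expR_right0|exact: C0_strongly_continuous].
rewrite scale1r in h => e0; have [d d0 hd] := (cvg_right0P _ _).1 h _ e0.
exists d => // t /andP[]; rewrite le_eqVlt => /predU1P[<- _|t0 td].
  by rewrite damped0 subrr normr0 ltW.
by apply: hd; rewrite t0.
Qed.

Definition riemann h x := limn (series (fun k => h *: S (k%:R * h) x)).

Let mulh_ge0 (h : R) k : 0 < h -> 0 <= k%:R * h.
Proof. by move=> h0; rewrite mulr_ge0// ltW. Qed.

(** On the cone the terms are dominated by a geometric series with sum [h / (1 - expR (- lam * h))],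
    which is at most [lam^-1 + h] because [1 + lam * h <= expR (lam * h)]. *)
Lemma riemannP (h : R) : 0 < h -> pos_op P (lam^-1 + h) (riemann h) /\
  forall x, series (fun k => h *: S (k%:R * h) x) @ \oo --> riemann h x.
Proof.
move=> h0.
have [] := @pos_op_series _ _ _ hX (lam^-1 + h) (fun k x => h *: S (k%:R * h) x).
- by move=> k a x y /=; rewrite (damped_linear (mulh_ge0 k h0)); module.
- move=> k p Pp; apply: (cone_scale hX); first exact: ltW.
  by have [_ + _] := pos_op_damped (mulh_ge0 k h0); apply.
- move=> n p Pp; pose a k : R := expR (- lam * (k%:R * h)).
  have le1 : expR (- lam * h) * (1 + lam * h) <= 1.
    rewrite mulNr expRN mulrC ler_pdivrMr ?expR_gt0// mul1r.
    exact: expR_ge1Dx.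
  (* Dominating each term by a difference makes the sum telescope. *)
  have step k : h * a k <= (lam^-1 + h) * (a k - a k.+1).
    have -> : a k.+1 = a k * expR (- lam * h).
      by rewrite /a -expRD; congr expR; rewrite -natr1; ring.
    rewrite -(ler_pM2l lam0).
    have -> : lam * ((lam^-1 + h) * (a k - a k * expR (- lam * h))) =
      a k * ((1 + lam * h) - expR (- lam * h) * (1 + lam * h)).
      by field; rewrite gt_eqF.
    have : 0 <= a k * (1 - expR (- lam * h) * (1 + lam * h)).
      by rewrite mulr_ge0 ?expR_ge0// subr_ge0.
    by rewrite -subr_ge0 => /le_trans; apply; rewrite le_eqVlt; apply/predU1P; left; ring.
  apply: (@le_trans _ _ ((lam^-1 + h) * (1 - a n) * `|p|)); last first.
    rewrite ler_wpM2r// ler_piMr ?addr_ge0 ?invr_ge0 ?(ltW lam0) ?(ltW h0)//.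
    by rewrite gerBl expR_ge0.
  elim: n => [|n IH].
    by rewrite big_nil /a mul0r mulr0 expR0 subrr mulr0 mul0r.
  rewrite big_nat_recr//= (le_trans (lerD IH (lexx _)))//.
  rewrite normrZ gtr0_norm//.
  have [_ _ /(_ _ Pp) hp] := pos_op_damped (mulh_ge0 n h0).
  apply: (@le_trans _ _ ((lam^-1 + h) * (1 - a n) * `|p| + h * a n * `|p|)).
    by rewrite lerD2l -mulrA ler_wpM2l// ltW.
  by rewrite -mulrDl ler_wpM2r//; have := step n; lra.
- move=> K hK cK; suff -> : riemann h = K by [].
  by apply/funext => x; apply: cvg_lim; [exact: norm_hausdorff|exact: cK].
Qed.

(** A shift by [m] steps drops the first [m] terms. This is the discrete form of the fact that
    [1 - S t] turns the integral over the half-line into the integral over [[0, t]]. *)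
Lemma riemann_shift (h : R) m x : 0 < h ->
  riemann h x - S (m%:R * h) (riemann h x) =
  h *: \sum_(0 <= k < m) S (k%:R * h) x.
Proof.
move=> h0; have [_ cv] := riemannP h0.
have mh := mulh_ge0 m h0.
have c1 := pos_op_cvg hX (pos_op_damped1 mh) (cv x).
have c2 : series (fun k => h *: S (k%:R * h) x) (n + m)%N @[n --> \oo] -->
    riemann h x by have := cv x; rewrite -(cvg_shiftn m).
apply: (cvgn_unique (cvgB c2 c1)).
apply: (eq_cvgn _ (cvg_cst _)) => n; rewrite !seriesEnat !fctE /=.
rewrite (lin_sum (damped_linear mh)) addnC (big_cat_nat (n := m))//= ?leq_addr//.
rewrite -[X in _ + \big[_/_]_(X <= _ < _) _]add0n big_addn addKn -scaler_sumr -addrA.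
rewrite [X in _ + (X - _)](eq_bigr (fun k => S (m%:R * h) (h *: S (k%:R * h) x))).
  by rewrite subrr addr0.
move=> k _; rewrite (linZ (damped_linear mh)) -dampedD ?mulh_ge0//.
by rewrite natrD; congr (_ *: S _ _); ring.
Qed.

Lemma dampedC (s t : R) x : 0 <= s -> 0 <= t -> S s (S t x) = S t (S s x).
Proof. by move=> s0 t0; rewrite -!dampedD// addrC. Qed.

Lemma riemann_damped (h : R) t x : 0 < h -> 0 <= t ->
  riemann h (S t x) = S t (riemann h x).
Proof.
move=> h0 t0; have [_ cv] := riemannP h0.
have c1 := pos_op_cvg hX (pos_op_damped1 t0) (cv x).
apply: (cvgn_unique (cv _)).
suff <- : S t \o series (fun k => h *: S (k%:R * h) x) =
  series (fun k => h *: S (k%:R * h) (S t x)) by [].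
apply/funext => n; rewrite /= !seriesEnat /= (lin_sum (damped_linear t0)).
apply: eq_bigr => k _; rewrite (linZ (damped_linear t0)).
by rewrite (dampedC _ t0)// mulh_ge0.
Qed.

Lemma riemann_linear (h : R) : 0 < h -> linear (riemann h).
Proof. by move=> /riemannP[[]]. Qed.

(** Thus [riemann h] inverts the difference quotient [(1 - S h) / h], the discrete counterpart of
    [lam] minus the generator. *)
Lemma riemann_inv (h : R) x : 0 < h -> riemann h (x - S h x) = h *: x.
Proof.
move=> h0; rewrite (linB (riemann_linear h0)) riemann_damped ?ltW//.
by have := riemann_shift 1 x h0; rewrite mul1r big_nat1 mul0r damped0.
Qed.

(** Grouping the terms in blocks of [m] writes a fine sum as a coarse one applied to an average of
    the orbit over one coarse step. By strong continuity this average is close to [x], which makes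
    the dyadic sums a Cauchy sequence. *)
Lemma riemann_refine (h : R) m x : 0 < h -> (0 < m)%N ->
  riemann h x = riemann (m%:R * h) (m%:R^-1 *: \sum_(0 <= k < m) S (k%:R * h) x).
Proof.
move=> h0 m0; have mh0 : 0 < m%:R * h by rewrite mulr_gt0// ltr0n.
apply: (scalerI (lt0r_neq0 mh0)); rewrite -riemann_inv// riemann_shift//.
have mN0 : (m%:R : R) != 0 by rewrite pnatr_eq0 -lt0n.
set s := \sum_(_ <= _ < _) _.
have -> : h *: s = (m%:R * h) *: (m%:R^-1 *: s) by module.
by rewrite (linZ (riemann_linear mh0)).
Qed.

Lemma riemann_bounded : exists2 M : R, 0 < M &
  forall h : R, 0 < h <= 1 -> forall x, `|riemann h x| <= M * `|x|.
Proof.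
have [M M0 hM] := pos_op_bounded hX.
have l1 : 0 < lam^-1 + 1 by rewrite addr_gt0// invr_gt0.
exists (M * (lam^-1 + 1)) => [|h /andP[h0 h1] x]; first by rewrite mulr_gt0.
have [[rl rP rC] _] := riemannP h0; apply: hM; first exact: ltW.
split=> // p Pp; rewrite (le_trans (rC _ Pp))// ler_wpM2r//.
by rewrite lerD2l.
Qed.

Let step n : R := 2^-1 ^+ n.

Let step_gt0 n : 0 < step n.
Proof. by rewrite exprn_gt0// invr_gt0. Qed.

Let step_le1 n : 0 < step n <= 1.
Proof. by rewrite step_gt0 exprn_ile1// ?invr_ge0// invf_le1// ler1n. Qed.

Let step_small (d : R) : 0 < d -> exists N, forall n, (N <= n)%N -> step n < d.
Proof.
move=> d0; have /(half_pow_small 1)[N hN] : 0 < d / 2 by rewrite divr_gt0.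
exists N => n /hN; rewrite mul1r => /le_lt_trans; apply.
by rewrite ltr_pdivrMr// ltr_pMr// ltr1n.
Qed.

Lemma riemann_cvg x : cvgn (fun n => riemann (step n) x).
Proof.
have [M M0 hM] := riemann_bounded.
apply: cauchy_tail_cvg => e e0.
have /(damped_right0 x)[d d0 hd] : 0 < e / M by rewrite divr_gt0.
have [N hN] := step_small d0; exists N => n Nn.
pose m := (2 ^ (n - N))%N.
have m0 : (0 < m)%N by rewrite expn_gt0.
have mstep : m%:R * step n = step N.
  rewrite /m /step -[in 2^-1 ^+ n](subnKC Nn) exprD natrX mulrCA -exprMn.
  by rewrite divff ?expr1n ?mulr1// pnatr_eq0.
rewrite (@riemann_refine _ m)// mstep -(linB (riemann_linear (step_gt0 N))).
rewrite (le_trans (hM _ (step_le1 N) _))// mulrC -ler_pdivlMr//.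
have mN0 : (m%:R : R) != 0 by rewrite pnatr_eq0 -lt0n.
have -> : m%:R^-1 *: (\sum_(0 <= k < m) S (k%:R * step n) x) - x =
    m%:R^-1 *: \sum_(0 <= k < m) (S (k%:R * step n) x - x).
  by rewrite sumrB sumr_const_nat subn0 scalerBr -(scaler_nat m x) scalerA mulVf// scale1r.
rewrite normrZ ger0_norm ?invr_ge0// ler_pdivrMl ?ltr0n//.
rewrite (le_trans (ler_norm_sum _ _ _))//.
rewrite mulr_natl -[X in _ *+ X]subn0 -(sumr_const_nat m 0) big_seq [leRHS]big_seq.
apply: ler_sum => k; rewrite mem_index_iota => /andP[_ km]; apply: hd.
rewrite mulh_ge0//= (lt_trans _ (hN _ (leqnn N)))// -mstep.
by rewrite ltr_pM2r// ltr_nat.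
Qed.

Definition laplace x := limn (fun n => riemann (step n) x).

Lemma laplace_cvg x : (fun n => riemann (step n) x) @ \oo --> laplace x.
Proof. exact: riemann_cvg. Qed.

Lemma pos_op_laplace : pos_op P lam^-1 laplace.
Proof.
apply: (@pos_op_limit _ _ _ hX _ (fun n => lam^-1 + step n)
          (fun n => riemann (step n))).
- by move=> n; have [] := riemannP (step_gt0 n).
- rewrite -[X in _ --> X]addr0; apply: cvgD; first exact: cvg_cst.
  by apply: (eq_cvgn _ (cvg_half_pow 1)) => n; rewrite mul1r.
- exact: laplace_cvg.
Qed.

Lemma laplace_damped (t : R) x : 0 <= t -> laplace (S t x) = S t (laplace x).
Proof.
move=> t0; apply: (cvgn_unique (x := fun n => riemann (step n) (S t x))).
  exact: laplace_cvg.
have := pos_op_cvg hX (pos_op_damped1 t0) (@laplace_cvg x).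
by apply: eq_cvgn => n; rewrite riemann_damped.
Qed.

(** The vector [laplace x - S t (laplace x)] is the integral of the orbit over [[0, t]], obtained
    from [riemann_shift] in the limit; if the orbit stays within [e] of [x], this integral is within
    [t * e] of [t *: x]. *)
Lemma laplace_estimate x (e d : R) : 0 <= e ->
  (forall t : R, 0 <= t < d -> `|S t x - x| <= e) ->
  forall t : R, 0 <= t < d ->
  `|laplace x - S t (laplace x) - t *: x| <= t * e.
Proof.
move=> e0 hd t /andP[t0 td].
(* [riemann_shift] only handles multiples of the step, so [t] is replaced by [tau n], the largest
   such multiple not exceeding it. *)
pose m n := Num.truncn (t / step n); pose tau n := (m n)%:R * step n.
have tau_ge0 n : 0 <= tau n by rewrite mulh_ge0.
have tau_le n : tau n <= t.
  by rewrite /tau -ler_pdivlMr// truncn_le divr_ge0// ltW.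
have tau_gt n : t - tau n < step n.
  rewrite ltrBlDl /tau -{2}[step n]mul1r -mulrDl natr1 -ltr_pdivrMr//.
  exact: truncnS_gt.
have tau_cvg : tau @ \oo --> t.
  apply/cvgn_distP => _/posnumP[c].
  have [N hN] := step_small (gt0 c); exists N => n /hN /ltW.
  by rewrite distrC ger0_norm ?subr_ge0//; apply: le_trans; exact: ltW.
pose y n := riemann (step n) x.
have yL : y @ \oo --> laplace x by exact: laplace_cvg.
have [M M0 hM] := pos_op_bounded hX.
have Sy : (fun n => S (tau n) (y n)) @ \oo --> S t (laplace x).
  apply/cvgn_distP => c c0.
  have cM : 0 < c / (2 * M) by rewrite divr_gt0// mulr_gt0.
  have [N1 hN1] := (cvgn_distP _ _).1 yL _ cM.
  have [d' d'0 hd'] := damped_right0 (laplace x) cM.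
  have [N2 hN2] := step_small d'0; exists (maxn N1 N2) => n.
  rewrite geq_max => /andP[/hN1 h1 /hN2 h2].
  have h3 : `|S (t - tau n) (laplace x) - laplace x| <= c / (2 * M).
    by apply: hd'; rewrite subr_ge0 tau_le (lt_trans (tau_gt n)).
  (* Factoring out [S (tau n)], which is bounded uniformly in [n], leaves only continuity at time 0
     to be used. *)
  have -> : S (tau n) (y n) - S t (laplace x) =
    S (tau n) (y n - laplace x - (S (t - tau n) (laplace x) - laplace x)).
    have -> : S t (laplace x) = S (tau n) (S (t - tau n) (laplace x)).
      by rewrite -dampedD ?subr_ge0// subrKC.
    by rewrite -(linB (damped_linear (tau_ge0 n))); congr (S _ _); module.
  rewrite (le_trans (hM 1 _ ler01 (pos_op_damped1 (tau_ge0 n)) _))// mulr1.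
  rewrite mulrC -ler_pdivlMr// (le_trans (ler_normB _ _))//.
  rewrite (le_trans (lerD h1 h3))// le_eqVlt; apply/predU1P; left.
  by field; rewrite gt_eqF.
have lim : (fun n => y n - S (tau n) (y n) - tau n *: x) @ \oo -->
    laplace x - S t (laplace x) - t *: x.
  by apply: cvgB; [exact: cvgB|exact: cvgZl].
apply: (cvgn_norm_le lim) => n; rewrite riemann_shift//.
have -> : tau n *: x = step n *: \sum_(0 <= k < m n) x.
  by rewrite sumr_const_nat subn0 -(scaler_nat (m n) x) scalerA mulrC.
rewrite -scalerBr -sumrB normrZ gtr0_norm//.
apply: (@le_trans _ _ (tau n * e)); last by rewrite ler_wpM2r.
rewrite /tau -mulrA mulrCA ler_wpM2l ?(ltW (step_gt0 n))//.
rewrite (le_trans (ler_norm_sum _ _ _))//.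
rewrite mulr_natl -[X in _ *+ X]subn0 -(sumr_const_nat (m n) 0) big_seq [leRHS]big_seq.
apply: ler_sum => k; rewrite mem_index_iota => /andP[_ km]; apply: hd.
rewrite mulh_ge0//= (le_lt_trans _ td)// (le_trans _ (tau_le n))//.
by rewrite ler_wpM2r ?(ltW (step_gt0 n))// ler_nat ltnW.
Qed.

(** The product rule at 0, used with [c = - lam] and with [c = lam] to pass from [T] to the damped
    semigroup and back. *)
Lemma right_deriv_expR (c : R) (F : R -> X) v g : F t @[t --> 0^'+] --> v ->
  t^-1 *: (F t - v) @[t --> 0^'+] --> g ->
  t^-1 *: (expR (c * t) *: F t - v) @[t --> 0^'+] --> g + c *: v.
Proof.
move=> Fv Fg.
have -> : (fun t => t^-1 *: (expR (c * t) *: F t - v)) =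
    fun t => t^-1 *: (F t - v) + (t^-1 * (expR (c * t) - 1)) *: F t.
  by apply/funext => t; module.
by apply: cvgD => //; apply: cvgZ => //; exact: expR_deriv_right0.
Qed.

Lemma laplace_right_deriv x :
  t^-1 *: (S t (laplace x) - laplace x) @[t --> 0^'+] --> - x.
Proof.
apply/cvg_right0P => e e0; have [d d0 hd] := damped_right0 x e0.
exists d => // t /andP[t0 td].
have := laplace_estimate (ltW e0) hd (_ : 0 <= t < d).
rewrite (ltW t0) => /(_ td); rewrite -ler_pdivrMl// => h; apply: le_trans h.
rewrite -[X in _ <= X * _]gtr0_norm ?invr_gt0// -normrZ -normrN.
rewrite le_eqVlt; apply/predU1P; left; congr `|_|.
have tN0 : t != 0 by rewrite gt_eqF.
by module.
Qed.

(** By [riemann_inv], [v] is the image under [riemann h] of minus the difference quotient of [v].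
    That quotient tends to [- x], and the operators [riemann h] are uniformly bounded. *)
Lemma resolvent_unique v x :
  t^-1 *: (S t v - v) @[t --> 0^'+] --> - x -> v = laplace x.
Proof.
move=> /cvg_right0P h; apply: (cvgn_unique _ (@laplace_cvg x)).
have [M M0 hM] := riemann_bounded.
apply/cvgn_distP => e e0.
have /h[d d0 hd] : 0 < e / M by rewrite divr_gt0.
have [N hN] := step_small d0; exists N => n /hN sn.
have sN0 : step n != 0 by rewrite gt_eqF.
have -> : riemann (step n) x - v =
    riemann (step n) ((step n)^-1 *: (S (step n) v - v) - - x).
  have -> : (step n)^-1 *: (S (step n) v - v) - - x =
     x - (step n)^-1 *: (v - S (step n) v) by module.
  rewrite (linB (riemann_linear (step_gt0 n))) (linZ (riemann_linear (step_gt0 n))).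
  by rewrite riemann_inv// scalerA mulVf// scale1r.
rewrite (le_trans (hM _ (step_le1 n) _))// mulrC -ler_pdivlMr//.
by apply: hd; rewrite step_gt0.
Qed.

Lemma gen_laplace v x :
  (gen_dom T v /\ lam *: v - gen T v = x) <-> v = laplace x.
Proof.
have Tcv := C0_strongly_continuous hC0.
split=> [[Dv <-]|->].
  have /(right_deriv_expR (c := - lam) (Tcv v)) :
    t^-1 *: (T t v - v) @[t --> 0^'+] --> gen T v by exact: Dv.
  have -> : gen T v + - lam *: v = - (lam *: v - gen T v) by module.
  exact: resolvent_unique.
have Scv : S t (laplace x) @[t --> 0^'+] --> laplace x.
  apply/cvg_right0P => e /(damped_right0 (laplace x))[d d0 hd].
  by exists d => // t /andP[t0 td]; apply: hd; rewrite ltW.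
have := right_deriv_expR (c := lam) Scv (@laplace_right_deriv x).
have -> : (fun t => t^-1 *: (expR (lam * t) *: S t (laplace x) - laplace x)) =
    fun t => t^-1 *: (T t (laplace x) - laplace x).
  by apply/funext => t; rewrite /damped scalerA mulNr -expRD subrr expR0 scale1r.
move=> cv; split; first by apply/cvg_ex; eexists; exact: cv.
rewrite /gen (cvg_lim _ cv)//; module.
Qed.

Lemma resolvent_laplace : resolvent (gen_dom T) (gen T) lam = laplace.
Proof.
apply/funext => x; apply: xget_unique; first exact/gen_laplace.
by move=> v /gen_laplace.
Qed.

Lemma resolvent_dense x (e : R) : 0 < e ->
  exists y, `|resolvent (gen_dom T) (gen T) lam y - x| <= e.
Proof.
move=> e0; have [d d0 hd] := damped_right0 x e0.
pose t := d / 2; have t0 : 0 < t by rewrite divr_gt0.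
have td : 0 <= t < d by rewrite ltW//= ltr_pdivrMr// ltr_pMr// ltr1n.
have tN0 : t != 0 by rewrite gt_eqF.
have Ll : linear laplace by case: pos_op_laplace.
(* The image of this vector under [laplace] is the average of the orbit of [x] over [[0, t]]. *)
exists (t^-1 *: (x - S t x)); rewrite resolvent_laplace (linZ Ll) (linB Ll).
rewrite laplace_damped ?(ltW t0)//.
have -> : t^-1 *: (laplace x - S t (laplace x)) - x =
  t^-1 *: (laplace x - S t (laplace x) - t *: x) by module.
rewrite normrZ gtr0_norm ?invr_gt0// ler_pdivrMl//.
exact: (laplace_estimate (ltW e0) hd).
Qed.

End Resolvent.

Arguments damped {R X} T lam t x.
Arguments riemann {R X} T lam h x.
Arguments laplace {R X} T lam x.

(** * Resolvent identity, approximation of the identity, and monotonicity of the resolvent *)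

Section ResolventTheory.
Context {R : realType} {X : completeNormedModType R} {P : set X}.
Hypothesis hX : abstract_state_space P.

Local Notation res T lam := (resolvent (gen_dom T) (gen T) lam).

Section Substochastic.
Context {T : R -> X -> X}.
Hypothesis hT : substochastic P T.

Lemma pos_op_resolvent (lam : R) : 0 < lam -> pos_op P lam^-1 (res T lam).
Proof. by move=> l0; rewrite (resolvent_laplace hX hT l0); exact: (pos_op_laplace hX hT). Qed.

Lemma resolvent_linear (lam : R) : 0 < lam -> linear (res T lam).
Proof. by move=> /pos_op_resolvent[]. Qed.

Lemma gen_resolvent (lam : R) v x : 0 < lam ->
  (gen_dom T v /\ lam *: v - gen T v = x) <-> v = res T lam x.
Proof.
by move=> l0; rewrite (resolvent_laplace hX hT l0); exact: (gen_laplace hX hT l0).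
Qed.

Lemma resolvent_dom (lam : R) x : 0 < lam -> gen_dom T (res T lam x).
Proof. by move=> l0; have [] := (gen_resolvent (res T lam x) x l0).2 erefl. Qed.

Lemma gen_resolventE (lam : R) x : 0 < lam ->
  gen T (res T lam x) = lam *: res T lam x - x.
Proof.
move=> l0; have [_ h] := (gen_resolvent (res T lam x) x l0).2 erefl.
by rewrite -{3}h; module.
Qed.

Lemma resolvent_genE (lam : R) v : 0 < lam -> gen_dom T v ->
  res T lam (lam *: v - gen T v) = v.
Proof. by move=> l0 Dv; apply/esym/gen_resolvent. Qed.

Lemma resolvent_identity (lam mu : R) x : 0 < lam -> 0 < mu ->
  res T lam x = res T mu (x + (mu - lam) *: res T lam x).
Proof.
move=> l0 m0; apply/gen_resolvent => //; split; first exact: resolvent_dom.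
by rewrite gen_resolventE//; module.
Qed.

End Substochastic.

Section Approximation.
Context {r : R -> X -> X}.
Hypothesis pos_op_r : forall lam : R, 0 < lam -> pos_op P lam^-1 (r lam).
Hypothesis r_identity : forall (lam mu : R) x, 0 < lam -> 0 < mu ->
  r lam x = r mu (x + (mu - lam) *: r lam x).
Hypothesis r_dense : forall x (e : R), 0 < e -> exists y, `|r 1 y - x| <= e.

(** On the range of [r 1] the error is of order [1 / n]; density and uniform boundedness extend the
    convergence to every vector. *)
Lemma resolvent_approx x :
  (fun n => n.+1%:R *: r n.+1%:R x) @ \oo --> x.
Proof.
have [M M0 hM] := pos_op_bounded hX.
apply/cvgn_distP => e e0.
have e'0 : 0 < e / 2 / (M + 1) by rewrite !divr_gt0// addr_gt0.
have [y hy] := r_dense x e'0; set v := r 1 y in hy.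
have n0 n : 0 < n.+1%:R :> R by [].
pose N := Num.truncn (M * `|v - y| / (e / 2)).
exists N => n Nn.
have rl := let: And3 l _ _ := pos_op_r (n0 n) in l.
have nN0 : n.+1%:R != 0 :> R by [].
(* For [v = r 1 y] the vector [v - y] is the image of [v] under the operator with resolvent family
   [r]. *)
have hv : n.+1%:R *: r n.+1%:R v - v = r n.+1%:R (v - y).
  rewrite {2}/v (r_identity y ltr01 (n0 n)) -/v -(linZ rl) -(linB rl).
  by congr (r _ _); module.
have -> : n.+1%:R *: r n.+1%:R x - x =
    n.+1%:R *: r n.+1%:R (x - v) + r n.+1%:R (v - y) + (v - x).
  by rewrite -hv (linB rl); module.
have ge0 : 0 <= (n.+1%:R : R)^-1 by rewrite invr_ge0.
have h1 := hM _ _ ge0 (pos_op_r (n0 n)) (x - v).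
have h2 := hM _ _ ge0 (pos_op_r (n0 n)) (v - y).
have h3 : M * n.+1%:R^-1 * `|v - y| <= e / 2.
  rewrite mulrAC ler_pdivrMr// [leRHS]mulrC -ler_pdivrMr ?divr_gt0//.
  by rewrite (le_trans (ltW (truncnS_gt _)))// ler_nat ltnS.
have h4 : `|n.+1%:R *: r n.+1%:R (x - v)| <= M * `|v - x|.
  rewrite normrZ ger0_norm// mulrC -ler_pdivlMr// (le_trans h1)//.
  by rewrite distrC mulrAC.
rewrite (le_trans (ler_normD _ _))// (le_trans (lerD (ler_normD _ _) (lexx _)))//.
rewrite (le_trans (lerD (lerD h4 (le_trans h2 h3)) (lexx _)))//.
have : (M + 1) * `|v - x| <= e / 2 by rewrite mulrC -ler_pdivlMr// addr_gt0.
lra.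
Qed.

End Approximation.

(** The comparison holds term by term in the Riemann sums, and the cone is closed. *)
Lemma resolvent_mono (T W : R -> X -> X) (lam : R) p :
  substochastic P T -> substochastic P W -> 0 < lam ->
  (forall (t : R) q, 0 <= t -> P q -> P (W t q - T t q)) ->
  P p -> P (res W lam p - res T lam p).
Proof.
move=> hT hW l0 TW Pp.
rewrite (resolvent_laplace hX hT l0) (resolvent_laplace hX hW l0).
apply: (cone_cvgB hX (@laplace_cvg _ _ _ _ _ hX hW l0 p) (@laplace_cvg _ _ _ _ _ hX hT l0 p)).
move=> n; set h := _ ^+ n.
have h0 : 0 < h by rewrite exprn_gt0// invr_gt0.
have [_ /(_ p) cT] := riemannP hX hT l0 h0.
have [_ /(_ p) cW] := riemannP hX hW l0 h0.
apply: (cone_cvgB hX cW cT).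
move=> m; rewrite !seriesEnat /= -sumrB.
apply: (cone_sum hX) => k _; rewrite -scalerBr /damped -scalerBr.
apply: (cone_scale hX); first exact: ltW.
apply: (cone_scale hX); first exact: expR_ge0.
by apply: TW => //; rewrite mulr_ge0// ltW.
Qed.

End ResolventTheory.

(** * Generation of substochastic semigroups *)

Section DenseSets.
Context {R : realType} {X : completeNormedModType R} {P : set X}.
Hypothesis hX : abstract_state_space P.
Context {D : set X}.
Hypothesis D_dense : forall x (e : R), 0 < e -> exists2 v, D v & `|v - x| <= e.

Lemma dense_cvgn (Kn : nat -> X -> X) : (forall n, pos_op P 1 (Kn n)) ->
  (forall v, D v -> cvgn (fun n => Kn n v)) -> forall x, cvgn (fun n => Kn n x).
Proof.
move=> hKn cD x; have [M M0 hM] := pos_op_bounded hX.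
apply: cauchy_tail_cvg => e e0.
have [v Dv vx] : exists2 v, D v & `|v - x| <= e / (4 * M).
  by apply: D_dense; rewrite divr_gt0// mulr_gt0.
have /cvg_ex[l /cvgn_distP/(_ (e / 4))[|N hN]] := cD _ Dv; first exact: divr_gt0.
exists N => n Nn.
have hd m : `|Kn m v - Kn m x| <= e / 4.
  have [Kl _ _] := hKn m; rewrite -(linB Kl) (le_trans (hM _ _ ler01 (hKn m) _))//.
  rewrite mulr1 mulrC -ler_pdivlMr// (le_trans vx)// le_eqVlt.
  by apply/predU1P; left; field; rewrite gt_eqF.
have -> : Kn n x - Kn N x = (Kn n v - l) - (Kn N v - l)
    - (Kn n v - Kn n x) + (Kn N v - Kn N x) by module.
rewrite (le_trans (ler_normD _ _))// (le_trans (lerD (ler_normB _ _) (lexx _)))//.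
rewrite (le_trans (lerD (lerD (ler_normB _ _) (lexx _)) (lexx _)))//.
have := hd n; have := hd N; have := hN _ Nn; have := hN _ (leqnn N).
lra.
Qed.

Lemma dense_eq C K L : 0 <= C -> pos_op P C K -> pos_op P C L ->
  (forall v, D v -> K v = L v) -> K =1 L.
Proof.
move=> C0 hK hL KL x; have [M M0 hM] := pos_op_bounded hX.
have [Kl _ _] := hK; have [Ll _ _] := hL.
apply/eqP; rewrite -subr_eq0 -normr_eq0 eq_le normr_ge0 andbT.
apply/ler_addgt0Pl => e e0; rewrite addr0.
have MC : 0 < M * C + 1 by rewrite ltr_wpDl// mulr_ge0// ltW.
have [v Dv vx] : exists2 v, D v & `|v - x| <= e / (2 * (M * C + 1)).
  by apply: D_dense; rewrite divr_gt0// mulr_gt0.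
have bd : M * C * `|v - x| <= e / 2.
  apply: (@le_trans _ _ ((M * C + 1) * `|v - x|)).
    by rewrite ler_wpM2r// lerDl.
  rewrite mulrC -ler_pdivlMr// (le_trans vx)// le_eqVlt.
  by apply/predU1P; left; field; rewrite gt_eqF.
have -> : K x - L x = L (v - x) - K (v - x).
  by rewrite (linB Kl) (linB Ll) (KL v)//; module.
rewrite (le_trans (ler_normB _ _))//.
have := hM _ _ C0 hK (v - x); have := hM _ _ C0 hL (v - x); lra.
Qed.

End DenseSets.

(* The semigroup is the limit of the implicit Euler scheme with step [2^-n];
   on the domain of the square of the generator the error is [O(2^-n)]. *)
Section Generation.
Context {R : realType} {X : completeNormedModType R} {P : set X}.
Hypothesis hX : abstract_state_space P.
Context {r : R -> X -> X}.
Hypothesis pos_op_r : forall lam : R, 0 < lam -> pos_op P lam^-1 (r lam).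
Hypothesis r_identity : forall (lam mu : R) x, 0 < lam -> 0 < mu ->
  r lam x = r mu (x + (mu - lam) *: r lam x).
Hypothesis r_dense : forall x (e : R), 0 < e -> exists y, `|r 1 y - x| <= e.

Let r_linear (lam : R) : 0 < lam -> linear (r lam).
Proof. by move=> /pos_op_r[]. Qed.

(** Adding the resolvent identities for [(lam, mu)] and [(mu, lam)] leaves [mu - lam] times the
    commutator. *)
Lemma resolvent_family_commute (lam mu : R) x : 0 < lam -> 0 < mu ->
  r lam (r mu x) = r mu (r lam x).
Proof.
move=> l0 m0; have [->//|lm] := eqVneq lam mu.
have h1 := r_identity x l0 m0; have h2 := r_identity x m0 l0.
rewrite (linD (r_linear m0)) (linZ (r_linear m0)) in h1.
rewrite (linD (r_linear l0)) (linZ (r_linear l0)) in h2.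
have ml : mu - lam != 0 by rewrite subr_eq0 eq_sym.
have : (mu - lam) *: (r lam (r mu x) - r mu (r lam x)) = 0.
  have -> : (mu - lam) *: (r lam (r mu x) - r mu (r lam x)) =
     (r lam x - (r mu x + (mu - lam) *: r mu (r lam x))) +
     (r mu x - (r lam x + (lam - mu) *: r lam (r mu x))) by module.
  by rewrite -h1 -h2 !subrr addr0.
by move/eqP; rewrite scaler_eq0 (negPf ml)/= subr_eq0 => /eqP.
Qed.

(* [resolvent_graph v g] says that [v] lies in the domain of the operator with
   resolvent family [r] and is sent to [g]. *)
Definition resolvent_graph (v g : X) := forall mu : R, 0 < mu -> r mu (mu *: v - g) = v.

Lemma resolvent_graph_r (lam : R) x : 0 < lam ->
  resolvent_graph (r lam x) (lam *: r lam x - x).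
Proof.
move=> l0 mu m0; rewrite [RHS](r_identity x l0 m0); congr (r _ _); module.
Qed.

Lemma resolvent_graph_lin a v g w h : resolvent_graph v g -> resolvent_graph w h ->
  resolvent_graph (a *: v - w) (a *: g - h).
Proof.
move=> vg wh mu m0; rewrite -{2}(vg _ m0) -{2}(wh _ m0).
rewrite -(linZ (r_linear m0)) -(linB (r_linear m0)); congr (r _ _); module.
Qed.

(** One implicit Euler step of length [h = 2^-n], that is, [(1 - h A)^-1] for the operator [A] with
    resolvent family [r]. *)
Definition euler n (x : X) : X := 2 ^+ n *: r (2 ^+ n) x.

Let pow_gt0 n : 0 < 2 ^+ n :> R.
Proof. exact: exprn_gt0. Qed.

Let pow_neq0 n : 2 ^+ n != 0 :> R.
Proof. by rewrite gt_eqF. Qed.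

Lemma pos_op_euler n : pos_op P 1 (euler n).
Proof.
rewrite -(divff (pow_neq0 n)); apply: (pos_op_scale hX); first exact: ltW.
exact: pos_op_r.
Qed.

Let euler_linear n : linear (euler n).
Proof. by have [] := pos_op_euler n. Qed.

Lemma resolvent_graph_euler n v g :
  resolvent_graph v g -> resolvent_graph (euler n v) (euler n g).
Proof.
move=> vg mu m0; rewrite -(linZ (euler_linear n)) -(linB (euler_linear n)).
rewrite /euler (linZ (r_linear m0)) resolvent_family_commute//.
by rewrite vg.
Qed.

Lemma resolvent_graph_iter n k v g : resolvent_graph v g ->
  resolvent_graph (iter k (euler n) v) (iter k (euler n) g).
Proof. by move=> vg; elim: k => //= k; exact: resolvent_graph_euler. Qed.

Lemma euler_graph n v g : resolvent_graph v g ->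
  euler n v = v + 2^-1 ^+ n *: euler n g.
Proof.
move=> /(_ _ (pow_gt0 n)); rewrite (linB (r_linear _))// (linZ (r_linear _))//.
move=> h; rewrite -{2}h /euler exprVn.
have := pow_neq0 n => ?; by module.
Qed.

Lemma euler_iter_sub n k v g K : resolvent_graph v g ->
  (forall j, `|iter j (euler n) g| <= K) ->
  `|iter k (euler n) v - v| <= k%:R * 2^-1 ^+ n * K.
Proof.
move=> vg gK; elim: k => [|k IH]; first by rewrite subrr normr0 !mul0r.
have -> : iter k.+1 (euler n) v - v =
    (iter k (euler n) v - v) + 2^-1 ^+ n *: iter k.+1 (euler n) g.
  rewrite [in LHS]iterS (euler_graph n (resolvent_graph_iter n k vg)) -iterS.
  module.
rewrite (le_trans (ler_normD _ _))// (le_trans (lerD IH (lexx _)))//.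
rewrite normrZ ger0_norm ?exprn_ge0 ?invr_ge0// -[k.+1%:R]natr1 2!mulrDl mul1r lerD2l.
by rewrite ler_wpM2l ?exprn_ge0 ?invr_ge0.
Qed.

Lemma euler_iter_taylor n k v g w K : resolvent_graph v g -> resolvent_graph g w ->
  (forall j, `|iter j (euler n) w| <= K) ->
  `|iter k (euler n) v - v - (k%:R * 2^-1 ^+ n) *: g|
    <= (k%:R * 2^-1 ^+ n) * ((k%:R * 2^-1 ^+ n) * K).
Proof.
move=> vg gw wK; set h := 2^-1 ^+ n.
have h0 : 0 <= h by rewrite exprn_ge0// invr_ge0.
have K0 : 0 <= K by apply: le_trans (wK 0%N).
(* The last factor keeps [k] fixed, so the bound is linear in [j] and the induction adds the same
   amount at each step. *)
suff H j : (j <= k)%N -> `|iter j (euler n) v - v - (j%:R * h) *: g|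
    <= (j%:R * h) * ((k%:R * h) * K) by exact: H.
elim: j => [|j IH] jk; first by rewrite subrr !mul0r scale0r subrr normr0.
have -> : iter j.+1 (euler n) v - v - (j.+1%:R * h) *: g =
    (iter j (euler n) v - v - (j%:R * h) *: g)
     + h *: (iter j.+1 (euler n) g - g).
  rewrite [in LHS]iterS (euler_graph n (resolvent_graph_iter n j vg)) -iterS.
  by rewrite -/h -[j.+1%:R]natr1; module.
rewrite (le_trans (ler_normD _ _))// (le_trans (lerD (IH (ltnW jk)) (lexx _)))//.
rewrite normrZ ger0_norm// -[j.+1%:R]natr1 2!mulrDl mul1r lerD2l ler_wpM2l//.
rewrite (le_trans (euler_iter_sub _ gw wK))// ler_wpM2r// ler_wpM2r//.
by rewrite ler_nat.
Qed.

(** Local error: one step of length [h] and two of length [h / 2] both agree with [v + h *: g] to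
    first order, so they differ by a multiple of [h ^+ 2]. *)
Lemma euler_halve n v g w M K : 0 <= K -> 1 <= M ->
  (forall n x, `|euler n x| <= M * `|x|) ->
  resolvent_graph v g -> resolvent_graph g w ->
  (forall j, `|iter j (euler n.+1) w| <= K) ->
  `|euler n v - euler n.+1 (euler n.+1 v)| <= (2 * M * K) * (2^-1 ^+ n * 2^-1 ^+ n).
Proof.
move=> K0 M1 hM vg gw wK; set h := 2^-1 ^+ n.
have h0 : 0 <= h by rewrite exprn_ge0// invr_ge0.
pose E := euler n.+1; have El : linear E := euler_linear n.+1.
have hS : (2^-1 : R) ^+ n.+1 = h / 2 by rewrite exprSr.
have -> : euler n v - euler n.+1 (euler n.+1 v) =
    (h * h) *: (euler n w - 2^-1 *: E w - 4^-1 *: E (E w)).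
  rewrite (euler_graph n vg) (euler_graph n gw) -/h -/E.
  have Eg x y : resolvent_graph x y -> E x = x + (h / 2) *: E y.
    by move=> /(euler_graph n.+1); rewrite hS.
  rewrite (Eg _ _ vg) (linD El) (linZ El) (Eg _ _ vg) (Eg _ _ gw).
  by rewrite (linD El) (linZ El) (Eg _ _ gw); module.
rewrite normrZ ger0_norm ?mulr_ge0// mulrC ler_wpM2r ?mulr_ge0//.
rewrite (le_trans (ler_normB _ _))// (le_trans (lerD (ler_normB _ _) (lexx _)))//.
rewrite [`|2^-1 *: _|]normrZ [`|4^-1 *: _|]normrZ !ger0_norm ?invr_ge0//.
have h1 := hM n w; have h2 := wK 0%N; have h3 := wK 1%N; have h4 := wK 2%N.
have h5 : M * `|w| <= M * K by rewrite ler_wpM2l// (le_trans _ M1).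
have h6 : K <= M * K by rewrite ler_peMl.
rewrite /= -/E in h2 h3 h4. lra.
Qed.

(** The [k] local errors add up, each one being propagated by a power of [euler n], bounded by [M].
    The hypothesis on [w] passes to [E (E w)], whose orbit is a tail of that of [w]. *)
Lemma euler_iter_halve n k v g w M K : 0 <= K -> 1 <= M ->
  (forall n k x, `|iter k (euler n) x| <= M * `|x|) ->
  resolvent_graph v g -> resolvent_graph g w ->
  (forall j, `|iter j (euler n.+1) w| <= K) ->
  `|iter k (euler n) v - iter k.*2 (euler n.+1) v|
    <= k%:R * (2 * M * M * K) * (2^-1 ^+ n * 2^-1 ^+ n).
Proof.
move=> K0 M1 hM + + +; elim: k v g w => [|k IH] v g w vg gw wK.
  by rewrite subrr normr0 !mul0r.
pose E := euler n.+1.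
have Fl := linear_iter (euler_linear n) k.
have -> : iter k.+1 (euler n) v - iter k.+1.*2 E v =
    iter k (euler n) (euler n v - E (E v)) +
    (iter k (euler n) (E (E v)) - iter k.*2 E (E (E v))).
  by rewrite doubleS !iterSr (linB Fl) subrKA.
rewrite (le_trans (ler_normD _ _))// -[k.+1%:R]natr1 2!mulrDl mul1r addrC lerD//.
  apply: (IH _ (E (E g)) (E (E w))).
  - exact/resolvent_graph_euler/resolvent_graph_euler.
  - exact/resolvent_graph_euler/resolvent_graph_euler.
  - by move=> j; rewrite -!iterSr.
rewrite (le_trans (hM _ _ _))//.
have := euler_halve K0 M1 (fun n => hM n 1%N) vg gw wK.
rewrite -/E => h; rewrite -mulrA -!mulrA mulrCA ler_wpM2l ?(le_trans ler01)//.
by rewrite !mulrA in h *.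
Qed.

Let M := s2val (cid2 (pos_op_bounded hX)) + 1.

Let M1 : 1 <= M.
Proof. by rewrite lerDr ltW//; case: (cid2 (pos_op_bounded hX)). Qed.

Let M0 : 0 <= M.
Proof. exact: le_trans M1. Qed.

Let iter_bounded n k x : `|iter k (euler n) x| <= M * `|x|.
Proof.
rewrite /M; case: (cid2 (pos_op_bounded hX)) => /= N N0 hN.
rewrite (le_trans (hN _ _ ler01 (pos_op_iter k (pos_op_euler n)) x))// mulr1.
by rewrite ler_wpM2r// lerDl.
Qed.

Let steps n (t : R) := Num.truncn (t * 2 ^+ n).

Definition euler_approx n (t : R) := iter (steps n t) (euler n).

Definition euler_semigroup (t : R) x := limn (fun n => euler_approx n t x).

Let hn n : R := 2^-1 ^+ n.

Let hn_ge0 n : 0 <= hn n.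
Proof. by rewrite exprn_ge0// invr_ge0. Qed.

Let steps_le n (t : R) : 0 <= t -> (steps n t)%:R * hn n <= t.
Proof.
by move=> t0; rewrite /hn exprVn ler_pdivrMr// truncn_le mulr_ge0// ltW.
Qed.

Let steps_gt n (t : R) : t - (steps n t)%:R * hn n <= hn n.
Proof.
rewrite lerBlDl -mulr_natl -[X in _ + X]mulr1 mulr_natl mulr1.
rewrite -{2}[hn n]mul1r -mulrDl natr1 /hn exprVn ler_pdivlMr// ltW//.
exact: truncnS_gt.
Qed.

Let steps_cvg (t : R) : 0 <= t -> (fun n => (steps n t)%:R * hn n) @ \oo --> t.
Proof.
move=> t0; apply/cvgn_distP => e /(half_pow_small 1)[N hN]; exists N => n /hN.
rewrite mul1r => /(le_trans (steps_gt n t)).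
by rewrite distrC ger0_norm// subr_ge0 steps_le.
Qed.

(** Halving the step doubles the number of steps up to one extra step, which moves a vector of the
    domain by [O(2^-n)] only. *)
Let steps_double n (t : R) : 0 <= t ->
  exists b : bool, steps n.+1 t = (b + (steps n t).*2)%N.
Proof.
move=> t0; set m := steps n t.
have t2 k : 0 <= t * 2 ^+ k by rewrite mulr_ge0// ltW.
have /andP[h1 h2] := truncn_itv (t2 n); rewrite -/(steps n t) -/m in h1 h2.
exists (m.*2 < steps n.+1 t)%N; apply/eqP; rewrite truncn_eq// exprS mulrCA.
have : (m.*2 <= steps n.+1 t)%N.
  by rewrite truncn_ge_nat// exprS mulrCA -mul2n natrM ler_wpM2l.
case: ltnP => [lt _|le _]; rewrite /= ?add1n ?add0n.
  rewrite truncn_gt_nat exprS mulrCA in lt.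
  by rewrite lt -doubleS -mul2n natrM ltr_pM2l.
rewrite truncn_le_nat exprS mulrCA in le.
by rewrite le andbT -mul2n natrM ler_wpM2l.
Qed.

Let steps_add n (s t : R) : 0 <= s -> 0 <= t ->
  exists b : bool, steps n (s + t) = (b + (steps n s + steps n t))%N.
Proof.
move=> s0 t0; have ge0 u : 0 <= u -> 0 <= u * 2 ^+ n :> R.
  by move=> u0; rewrite mulr_ge0// ltW.
have /andP[h1 h2] := truncn_itv (ge0 _ s0).
have /andP[h3 h4] := truncn_itv (ge0 _ t0).
have le : (steps n s + steps n t <= steps n (s + t))%N.
  by rewrite truncn_ge_nat ?ge0 ?addr_ge0// natrD mulrDl lerD.
exists (steps n s + steps n t < steps n (s + t))%N.
have lt : (steps n (s + t) < (steps n s + steps n t).+2)%N.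
  rewrite truncn_lt_nat ?ge0 ?addr_ge0// mulrDl (lt_le_trans (ltrD h2 h4))//.
  by rewrite -natrD ler_nat addSn addnS.
by case: ltnP => h; apply/eqP; rewrite eqn_leq ?add1n ?add0n ?le ?h ?andbT.
Qed.

Definition domain2 : set X :=
  [set v | exists g w, resolvent_graph v g /\ resolvent_graph g w].

Lemma domain2_dense x (e : R) : 0 < e -> exists2 v, domain2 v & `|v - x| <= e.
Proof.
move=> e0; have e2 : 0 < e / (2 * M) by rewrite divr_gt0// mulr_gt0// (lt_le_trans _ M1).
have [y hy] : exists y, `|r 1 y - x| <= e / 2 by apply: r_dense; rewrite divr_gt0.
(* Two resolvents put the vector in the domain of the square: [r 1 y] is close to [x], then [r 1 z]
   is close to [y]. *)
have [z hz] := r_dense y e2; exists (r 1 (r 1 z)).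
  exists (1 *: r 1 (r 1 z) - r 1 z).
  exists (1 *: (1 *: r 1 (r 1 z) - r 1 z) - (1 *: r 1 z - z)).
  split; first exact: resolvent_graph_r.
  by apply: resolvent_graph_lin; exact: resolvent_graph_r.
have -> : r 1 (r 1 z) - x = r 1 (r 1 z - y) + (r 1 y - x).
  by rewrite (linB (r_linear ltr01)) subrKA.
rewrite (le_trans (ler_normD _ _))// [leRHS]splitr lerD//.
have := iter_bounded 0 1 (r 1 z - y).
rewrite /= /euler expr0 scale1r => /le_trans; apply.
rewrite -ler_pdivlMl ?(lt_le_trans _ M1)// (le_trans hz)// le_eqVlt.
by apply/predU1P; left; field; rewrite gt_eqF// (lt_le_trans _ M1).
Qed.

(** The term in [g] pays for the possible extra step; the other one collects at most [t / h] local
    errors of order [h ^+ 2], where [h = 2^-n]. *)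
Lemma euler_approx_half n (t : R) v g w : 0 <= t ->
  resolvent_graph v g -> resolvent_graph g w ->
  `|euler_approx n.+1 t v - euler_approx n t v|
    <= (M * `|g| + t * (2 * M * M * (M * `|w|))) * hn n.
Proof.
move=> t0 vg gw; have [b hb] := steps_double n t0.
rewrite /euler_approx hb iterD; set m := steps n t.
rewrite -(subrKA (iter m.*2 (euler n.+1) v)) (le_trans (ler_normD _ _))//.
rewrite mulrDl lerD//.
  have gK j : `|iter j (euler n.+1) (iter m.*2 (euler n.+1) g)| <= M * `|g|.
    by rewrite -iterD.
  have gr := resolvent_graph_iter n.+1 m.*2 vg.
  rewrite (le_trans (euler_iter_sub b gr gK))// mulrC ler_wpM2l ?mulr_ge0//.
  rewrite -/(hn n.+1) (@le_trans _ _ (hn n.+1))//.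
    by rewrite ler_piMl//; case: (b).
  by rewrite /hn exprS ler_piMl// invf_le1// ler1n.
have K0 : 0 <= M * `|w| by rewrite mulr_ge0.
rewrite distrC.
rewrite (le_trans (euler_iter_halve m K0 M1 iter_bounded vg gw (iter_bounded n.+1 ^~ w)))//.
rewrite -/(hn n) [leLHS]mulrA ler_wpM2r// mulrAC ler_wpM2r//.
  by rewrite !mulr_ge0.
exact: steps_le.
Qed.

Lemma pos_op_euler_approx n (t : R) : pos_op P 1 (euler_approx n t).
Proof. exact/pos_op_iter/pos_op_euler. Qed.

Lemma euler_approx_cvg (t : R) x : 0 <= t ->
  (fun n => euler_approx n t x) @ \oo --> euler_semigroup t x.
Proof.
move=> t0; apply: (dense_cvgn hX domain2_dense (Kn := fun n => euler_approx n t)).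
  by move=> n; exact: pos_op_euler_approx.
move=> v [g [w [vg gw]]]; apply: cvg_geometric_rate => n.
exact: (euler_approx_half n t0 vg gw).
Qed.

Lemma pos_op_euler_semigroup (t : R) : 0 <= t -> pos_op P 1 (euler_semigroup t).
Proof.
move=> t0; apply: (pos_op_limit hX (c := fun=> 1) (Kn := fun n => euler_approx n t)).
- by move=> n; exact: pos_op_euler_approx.
- exact: cvg_cst.
- by move=> x; exact: euler_approx_cvg.
Qed.

Let hn_cvg : hn @ \oo --> (0 : R).
Proof. by apply: (eq_cvgn _ (cvg_half_pow 1)) => n; rewrite mul1r. Qed.

(** At level [n] the law holds up to one Euler step, by rounding; this is the term [y] below, while
    [z] accounts for replacing the inner approximation by its limit. *)
Lemma euler_semigroup_add (s t : R) x : 0 <= s -> 0 <= t ->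
  euler_semigroup (s + t) x = euler_semigroup s (euler_semigroup t x).
Proof.
move=> s0 t0; have st0 : 0 <= s + t by rewrite addr_ge0.
apply: (dense_eq hX domain2_dense ler01 (pos_op_euler_semigroup st0)
          (L := euler_semigroup s \o euler_semigroup t)).
  rewrite -[1]mulr1.
  exact: (pos_op_comp ler01 (pos_op_euler_semigroup s0) (pos_op_euler_semigroup t0)).
move=> v [g [w [vg gw]]] /=.
apply/eqP; rewrite -subr_eq0 -normr_le0.
pose y n := euler_approx n (s + t) v - euler_approx n s (euler_approx n t v).
pose z n := euler_approx n s (euler_approx n t v - euler_semigroup t v).
have yC n : `|y n| <= hn n * (M * `|g|).
  have [b hb] := steps_add n s0 t0.
  rewrite /y /euler_approx hb (iterD b) -(iterD (steps n s)).
  have gr := resolvent_graph_iter n (steps n s + steps n t) vg.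
  have gK j : `|iter j (euler n) (iter (steps n s + steps n t) (euler n) g)| <= M * `|g|.
    by rewrite -iterD.
  rewrite (le_trans (euler_iter_sub b gr gK))// ler_wpM2r ?mulr_ge0//.
  by rewrite ler_piMl//; case: (b).
have zC n : `|z n| <= M * `|euler_approx n t v - euler_semigroup t v|.
  exact: iter_bounded.
have lim : (fun n => `|euler_approx n (s + t) v - euler_approx n s (euler_semigroup t v)|)
    @ \oo --> `|euler_semigroup (s + t) v - euler_semigroup s (euler_semigroup t v)|.
  by apply: cvg_norm; apply: cvgB; exact: euler_approx_cvg.
have lim0 : (fun n => hn n * (M * `|g|) + M * `|euler_approx n t v - euler_semigroup t v|)
    @ \oo --> (0 : R).
  rewrite -[X in _ --> X]addr0; apply: cvgD.
    by rewrite -(mul0r (M * `|g|)); apply: cvgMl; exact: hn_cvg.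
  rewrite -[X in _ --> X](mulr0 M); apply: cvgMr.
  rewrite -(normr0 X) -(subrr (euler_semigroup t v)).
  by apply: cvg_norm; apply: cvgB; [exact: euler_approx_cvg|exact: cvg_cst].
apply: (ler_cvg_to lim lim0); apply: nearW => n.
have -> : euler_approx n (s + t) v - euler_approx n s (euler_semigroup t v) = y n + z n.
  have [Al _ _] := pos_op_euler_approx n s.
  by rewrite /y /z (linB Al) subrKA.
by rewrite (le_trans (ler_normD _ _))// lerD.
Qed.

Lemma euler_semigroup0 x : euler_semigroup 0 x = x.
Proof.
apply: (cvgn_unique (euler_approx_cvg (x := x) (lexx 0))).
by apply: (eq_cvgn _ (cvg_cst x)) => n; rewrite /euler_approx /steps mul0r truncn0.
Qed.

Lemma euler_semigroup_taylor (t : R) v g w : 0 <= t ->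
  resolvent_graph v g -> resolvent_graph g w ->
  `|euler_semigroup t v - v - t *: g| <= t * (t * (M * `|w|)).
Proof.
move=> t0 vg gw; pose tau n := (steps n t)%:R * hn n.
have lim : (fun n => euler_approx n t v - v - tau n *: g) @ \oo -->
    euler_semigroup t v - v - t *: g.
  apply: cvgB; last by apply: cvgZl; exact: steps_cvg.
  by apply: cvgB; [exact: euler_approx_cvg|exact: cvg_cst].
apply: (cvgn_norm_le lim) => n.
rewrite (le_trans (euler_iter_taylor _ vg gw (iter_bounded n ^~ w)))//.
have tau0 : 0 <= tau n by rewrite mulr_ge0.
rewrite ler_pM ?mulr_ge0// ?steps_le// ler_wpM2r ?mulr_ge0//.
exact: steps_le.
Qed.

Lemma euler_semigroup_right0 x : euler_semigroup t x @[t --> 0^'+] --> x.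
Proof.
apply/cvg_right0P => e e0.
have [v [g [w [vg gw]]] vx] : exists2 v, domain2 v & `|v - x| <= e / (4 * M).
  by apply: domain2_dense; rewrite divr_gt0// mulr_gt0// (lt_le_trans _ M1).
pose C := `|g| + M * `|w| + 1.
have C0 : 0 < C by rewrite ltr_wpDl// addr_ge0// mulr_ge0.
exists (Num.min 1 (e / 4 / C)) => [|t /andP[t0]].
  by rewrite lt_min ltr01 !divr_gt0.
rewrite lt_min => /andP[t1 te].
have h1 : `|euler_semigroup t v - v| <= e / 4.
  rewrite -(subrK (t *: g) (euler_semigroup t v - v)) (le_trans (ler_normD _ _))//.
  rewrite (le_trans (lerD (euler_semigroup_taylor (ltW t0) vg gw) (lexx _)))//.
  rewrite normrZ gtr0_norm// -mulrDr.
  apply: (@le_trans _ _ (t * C)).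
    rewrite ler_wpM2l ?(ltW t0)// /C.
    have : t * (M * `|w|) <= M * `|w| by rewrite ler_piMl ?mulr_ge0// ltW.
    lra.
  by rewrite -ler_pdivlMr// ltW.
have h2 : `|euler_semigroup t (x - v)| <= e / 4.
  apply: (@le_trans _ _ (M * `|x - v|)).
    apply: (cvgn_norm_le (euler_approx_cvg (ltW t0))) => n; exact: iter_bounded.
  rewrite distrC mulrC -ler_pdivlMr ?(lt_le_trans _ M1)// (le_trans vx)// le_eqVlt.
  by apply/predU1P; left; field; rewrite gt_eqF// (lt_le_trans _ M1).
have h3 : `|v - x| <= e / 4.
  rewrite (le_trans vx)// ler_wpM2l ?(ltW e0)// lef_pV2 ?posrE//.
    by rewrite ler_peMr.
  by rewrite mulr_gt0// (lt_le_trans _ M1).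
have [El _ _] := pos_op_euler_semigroup (ltW t0).
have -> : euler_semigroup t x - x =
    euler_semigroup t (x - v) + (euler_semigroup t v - v) + (v - x).
  by rewrite (linB El); module.
rewrite (le_trans (ler_normD _ _))// (le_trans (lerD (ler_normD _ _) (lexx _)))//.
lra.
Qed.

Lemma substochastic_euler : substochastic P euler_semigroup.
Proof.
have El (t : R) : 0 <= t -> linear (euler_semigroup t).
  by move=> /pos_op_euler_semigroup[].
split; last 2 first.
- by move=> t p /pos_op_euler_semigroup[_ + _]; apply.
- by move=> t p /pos_op_euler_semigroup[_ _ h] /h; rewrite mul1r.
split.
- exact: El.
- by move=> t /pos_op_euler_semigroup/(pos_op_continuous hX).
- exact: euler_semigroup0.
- exact: euler_semigroup_add.
- exact: euler_semigroup_right0.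
Qed.

Lemma gen_euler v g w : resolvent_graph v g -> resolvent_graph g w ->
  gen_dom euler_semigroup v /\ gen euler_semigroup v = g.
Proof.
move=> vg gw.
have h : t^-1 *: (euler_semigroup t v - v) @[t --> 0^'+] --> g.
  apply/cvg_right0P => e e0; pose C := M * `|w| + 1.
  have C0 : 0 < C by rewrite ltr_wpDl// mulr_ge0.
  exists (e / C) => [|t /andP[t0 te]]; first exact: divr_gt0.
  have tN0 : t != 0 by rewrite gt_eqF.
  have -> : t^-1 *: (euler_semigroup t v - v) - g =
      t^-1 *: (euler_semigroup t v - v - t *: g) by module.
  rewrite normrZ gtr0_norm ?invr_gt0// ler_pdivrMl//.
  rewrite (le_trans (euler_semigroup_taylor (ltW t0) vg gw))//.
  rewrite ler_wpM2l ?(ltW t0)// (@le_trans _ _ (t * C))//.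
    by rewrite ler_wpM2l ?(ltW t0)// lerDl.
  by rewrite -ler_pdivlMr// ltW.
split; first by apply/cvg_ex; exists g.
by rewrite /gen (cvg_lim _ h).
Qed.

(** [gen_euler] only identifies the generator on the domain of the square. This suffices: [r lam]
    maps the dense range of [r 1] into that domain, and both sides are bounded. *)
Lemma resolvent_euler (lam : R) : 0 < lam ->
  resolvent (gen_dom euler_semigroup) (gen euler_semigroup) lam = r lam.
Proof.
move=> l0; have hE := substochastic_euler.
apply/funext; pose D := range (r 1).
have D_dense x (e : R) : 0 < e -> exists2 v, D v & `|v - x| <= e.
  by move=> /(r_dense x)[y hy]; exists (r 1 y) => //; exists y.
have linv0 : 0 <= lam^-1 by rewrite invr_ge0 ltW.
apply: (dense_eq hX D_dense linv0 (pos_op_resolvent hX hE l0) (pos_op_r l0)).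
move=> _ [y _ <-]; apply/esym/(gen_resolvent hX hE) => //.
have vg := resolvent_graph_r (r 1 y) l0.
have xg := resolvent_graph_r y ltr01.
have [Dv ->] := gen_euler vg (resolvent_graph_lin lam vg xg).
by split => //; module.
Qed.

End Generation.

Arguments euler_semigroup {R X} r t x.

(** * Weak topologies *)

Section CompactClosure.
Context {T : topologicalType}.

(* No separation of points is assumed: the Hausdorff property of a weak topology
   would require the Hahn-Banach theorem. *)
Lemma regular_precompact (A : set T) : regular_space T -> compact A -> precompact A.
Proof.
move=> reg cA; rewrite precompactE => F FF FA.
(* The filter [F] lives on the closure of [A] and may miss [A] itself, but its open members meet
   [A]; their traces generate a filter on [A]. *)
pose H := [set S : set T | exists Q, [/\ open Q, F Q & Q `&` A `<=` S]].
have HF : ProperFilter H.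
  split; last split.
  - move=> [Q [oQ FQ Q0]]; have [z [Qz Az]] := filter_ex (filterI FQ FA).
    have [y [Ay Qy]] := Az _ (open_nbhs_nbhs (conj oQ Qz)).
    exact: (Q0 y).
  - by exists setT; split=> //; [exact: openT|exact: filterT].
  - move=> S S' [Q [oQ FQ QS]] [Q' [oQ' FQ' QS']]; exists (Q `&` Q').
    split; [exact: openI|exact: filterI|].
    by move=> y [[Qy Q'y] Ay]; split; [exact: QS|exact: QS'].
  - move=> S S' SS' [Q [oQ FQ QS]]; exists Q; split=> //.
    exact: subset_trans QS SS'.
have HA : H A by exists setT; split; [exact: openT|exact: filterT|exact: subIsetr].
have [p [Ap Hp]] := cA H HF HA.
exists p; split; first exact: subset_closure.
(* If [G] missed the neighbourhood [C], the complement of a closed neighbourhood inside [C] would be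
   an open member of [F] avoiding a neighbourhood of [p]. *)
move=> G C FG /reg[D nD DC]; apply: contrapT => GC0.
have HD : H (~` closure D `&` A).
  exists (~` closure D); split=> //; first exact/closed_openC/closed_closure.
  by apply: filterS FG => y Gy Dy; apply: GC0; exists y; split=> //; exact: DC.
by have [y [[Dy _] /subset_closure]] := Hp _ _ HD nD.
Qed.

End CompactClosure.

Section WeakTopology.
Context {R : realType} {X : completeNormedModType R}.

(** The weak topology comes from a supremum of uniform structures, and uniform spaces are
    regular. *)
Lemma weak_regular : regular_space (weak X).
Proof.
exact: (@uniform_regular (sup_topology (fun f : dual X =>
  Uniform.class (initial_topology (sval f : X -> R^o))))).
Qed.

Lemma weak_continuous (f : dual X) : continuous (sval f : weak X -> R^o).
Proof.
move=> z; have /cvg_sup/(_ f) h : nbhs z --> (z : weak X) by [].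
exact: (cvg_comp _ _ h (@initial_continuous _ _ (sval f : X -> R^o) z)).
Qed.

Lemma weak_cvg (x : X ^nat) (l : X) :
  x @ \oo --> l -> x @ \oo --> (l : weak X).
Proof.
move=> xl; apply/cvg_sup => f A.
rewrite nbhsE => -[B [[C oC <-] Cl] BA].
have fx : sval f (x n) @[n --> \oo] --> sval f l.
  by apply: (cvg_comp _ _ xl); exact: (svalP f).
apply: filterS BA _; apply: (fx C).
exact: open_nbhs_nbhs.
Qed.

(** The sequence together with its limit is weakly compact: a filter on it that does not cluster at
    the limit contains a finite set of terms. *)
Lemma cvg_relatively_weakly_compact (x : X ^nat) (l : X) : x @ \oo --> l ->
  relatively_weakly_compact (range x).
Proof.
move=> /weak_cvg xl; pose A : set (weak X) := [set l] `|` range x.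
apply: (@precompact_subset _ _ A); first by move=> y; right.
apply: (regular_precompact weak_regular) => F FF FA.
have [|] := pselect (cluster F (l : weak X)); first by exists l; split=> //; left.
move=> /existsNP[G /existsNP[V /not_implyP[FG /not_implyP[nV GV]]]].
have [N _ hN] := xl _ nV.
have cB : compact (x @` `I_N : set (weak X)).
  by apply: finite_compact; apply: finite_image; exact: finite_II.
have FB : F (x @` `I_N).
  apply: filterS (filterI FG FA) => y [Gy [yl|[n _ xn]]].
    by case: GV; exists y; split=> //; rewrite yl; exact: nbhs_singleton nV.
  exists n => //=; rewrite ltnNge; apply/negP => /hN Vn.
  by apply: GV; exists y; split=> //; rewrite -xn.
have [p [[n _ <-] Fp]] := cB F FF FB.
by exists (x n); split=> //; right; exists n.
Qed.

(** Any weak cluster point will do, and no subsequence is extracted: where the values of a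
    functional converge, the cluster point must take their limit. *)
Lemma weak_cluster_value (x : X ^nat) : relatively_weakly_compact (range x) ->
  exists z, forall (f : {linear X -> R^o}) (l : R), continuous f ->
    f (x n) @[n --> \oo] --> l -> f z = l.
Proof.
rewrite /relatively_weakly_compact precompactE => cx.
have [z [_ xz]] : closure (range x : set (weak X)) `&`
    cluster (x @ \oo : set_system (weak X)) !=set0.
  by apply: cx; exists 0%N => // n _; apply: subset_closure; exists n.
exists z => f l cf fx.
apply/eqP; rewrite -subr_eq0 -normr_le0; apply/ler_addgt0Pl => e e0; rewrite addr0.
have e2 : 0 < e / 2 by rewrite divr_gt0.
have [N hN] := (cvgn_distP _ _).1 fx _ e2.
pose fd : dual X := exist _ f cf.
have nz : nbhs (z : weak X) [set y | `|f z - f y| <= e / 2].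
  have /cvgrPdist_le/(_ _ e2) := @weak_continuous fd z; exact.
have FN : (x @ \oo) [set x n | n in [set n | (N <= n)%N]].
  by exists N => // n Nn; exists n.
have [_ [[n Nn <-] /= h]] := xz _ _ FN nz.
rewrite -(subrKA (f (x n))) (le_trans (ler_normD _ _))// [leRHS]splitr lerD//.
exact: hN.
Qed.

End WeakTopology.

(** * The minimal semigroup *)

Section Kato.
Context {R : realType} {X : completeNormedModType R} {P : set X}.
Context {Psi : {linear X -> R^o}} {U : R -> X -> X} {B : X -> X}.
Hypotheses (hX : abstract_state_space P) (hPsi : norm_functional P Psi).
Hypothesis hU : substochastic P U.
Hypothesis hBlin : linear_on (gen_dom U) B.
Hypothesis hBpos : positive_on P (gen_dom U) B.
Hypothesis hAB : forall v, gen_dom U v -> P v ->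
  Psi (perturbation U B v) <= (0 : R).

Local Notation r := (resA U).
Local Notation K := (BresA U B).

Let PsiE p : P p -> Psi p = `|p|. Proof. exact: (norm_functionalE hPsi). Qed.

Let r_pos (lam : R) : 0 < lam -> pos_op P lam^-1 (r lam).
Proof. exact: (pos_op_resolvent hX hU). Qed.

Let r_linear (lam : R) : 0 < lam -> linear (r lam).
Proof. by move=> /r_pos[]. Qed.

Let r_cone (lam : R) p : 0 < lam -> P p -> P (r lam p).
Proof. by move=> /r_pos[_ + _]; apply. Qed.

Let r_dom (lam : R) x : 0 < lam -> gen_dom U (r lam x).
Proof. exact: (resolvent_dom hX hU). Qed.

Lemma BresA_linear (lam : R) : 0 < lam -> linear (K lam).
Proof.
by move=> l0 a x y; rewrite /BresA (r_linear l0) hBlin//; exact: r_dom.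
Qed.

Lemma BresA_cone (lam : R) p : 0 < lam -> P p -> P (K lam p).
Proof. by move=> l0 Pp; apply: hBpos; [exact: r_dom|exact: r_cone]. Qed.

Lemma perturbation_resA (lam : R) x : 0 < lam ->
  perturbation U B (r lam x) = lam *: r lam x - (x - K lam x).
Proof.
by move=> l0; rewrite /perturbation /BresA (gen_resolventE hX hU x l0) opprB addrAC addrA.
Qed.

(** Mass balance: this is [hAB] at [r lam p], where [Psi] is the norm on each of the three cone
    elements involved. *)
Lemma BresA_norm (lam : R) p : 0 < lam -> P p ->
  lam * `|r lam p| <= `|p| - `|K lam p|.
Proof.
move=> l0 Pp; have := hAB (r_dom (x := p) l0) (r_cone l0 Pp).
rewrite perturbation_resA// !linearB linearZ /= !PsiE//.
- by rewrite /GRing.scale /=; lra.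
- exact: BresA_cone.
- exact: r_cone.
Qed.

Lemma pos_op_BresA (lam : R) : 0 < lam -> pos_op P 1 (K lam).
Proof.
move=> l0; split; [exact: BresA_linear|by move=> p; exact: BresA_cone|].
move=> p Pp; rewrite mul1r -subr_ge0 (le_trans _ (BresA_norm l0 Pp))//.
by rewrite mulr_ge0// ltW.
Qed.

Let K_iter (lam : R) n : 0 < lam -> pos_op P 1 (iter n (K lam)).
Proof. by move=> /pos_op_BresA; exact: pos_op_iter. Qed.

Let K_cone (lam : R) n p : 0 < lam -> P p -> P (iter n (K lam) p).
Proof. by move=> /(K_iter n)[_ + _]; apply. Qed.

Definition kato (lam : R) (x : X) : X :=
  limn (series (fun n => r lam (iter n (K lam) x))).

(** Summed along the orbit, [BresA_norm] telescopes and bounds [lam] times the norms of the terms by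
    the mass lost, hence by the norm of [p]. *)
Lemma katoP (lam : R) : 0 < lam -> pos_op P lam^-1 (kato lam) /\
  forall x, series (fun n => r lam (iter n (K lam) x)) @ \oo --> kato lam x.
Proof.
move=> l0.
have [] := pos_op_series hX (C := lam^-1) (Kn := fun n => r lam \o iter n (K lam)).
- by move=> n a x y; have [Kl _ _] := K_iter n l0; rewrite /= Kl (r_linear l0).
- by move=> n p Pp; apply: r_cone => //; exact: K_cone.
- move=> n p Pp; rewrite -(ler_pM2l l0) mulrA divff ?gt_eqF// mul1r.
  apply: (@le_trans _ _ (`|p| - `|iter n (K lam) p|)); last by rewrite gerBl.
  elim: n => [|n IH]; first by rewrite big_nil mulr0 subrr.
  rewrite big_nat_recr//= mulrDr (le_trans (lerD IH (BresA_norm l0 (K_cone n l0 Pp))))//.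
  by rewrite subrKA.
- move=> L hL cL; suff -> : kato lam = L by [].
  by apply/funext => x; apply: cvg_lim; [exact: norm_hausdorff|exact: cL].
Qed.

Lemma pos_op_kato (lam : R) : 0 < lam -> pos_op P lam^-1 (kato lam).
Proof. by move=> /katoP[]. Qed.

Let kato_linear (lam : R) : 0 < lam -> linear (kato lam).
Proof. by move=> /pos_op_kato[]. Qed.

Lemma kato_cvg (lam : R) x : 0 < lam ->
  (fun N => \sum_(0 <= n < N) r lam (iter n (K lam) x)) @ \oo --> kato lam x.
Proof. by move=> /katoP[_ /(_ x)]; rewrite seriesEnat. Qed.

Lemma resA_iter_cvg0 (lam : R) x : 0 < lam ->
  (fun n => r lam (iter n (K lam) x)) @ \oo --> (0 : X).
Proof.
move=> /katoP[_ /(_ x) cv]; apply: cvg_series_cvg_0.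
by apply/cvg_ex; exists (kato lam x).
Qed.

(** Stated for any left factor [L], since it serves both for [kato] and for the resolvent of the
    minimal semigroup before the two are identified. *)
Lemma telescope_resA (lam : R) (L : X -> X) x N : linear L ->
  (forall y, L (y - K lam y) = r lam y) ->
  L x - L (iter N (K lam) x) = \sum_(0 <= n < N) r lam (iter n (K lam) x).
Proof.
move=> Ll hL; elim: N => [|N IH]; first by rewrite big_nil subrr.
by rewrite big_nat_recr//= -IH -hL (linB Ll) subrKA.
Qed.

Lemma kato_resA (lam : R) x : 0 < lam -> kato lam (x - K lam x) = r lam x.
Proof.
move=> l0; apply: (cvgn_unique (kato_cvg (x := _) l0)).
have c0 : (fun N => r lam x - r lam (iter N (K lam) x)) @ \oo --> r lam x - 0.
  by apply: cvgB; [exact: cvg_cst|exact: resA_iter_cvg0].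
rewrite subr0 in c0; apply: (eq_cvgn _ c0) => N.
elim: N => [|N IH]; first by rewrite big_nil subrr.
have [Kl _ _] := K_iter N l0.
by rewrite big_nat_recr//= IH (linB Kl) -iterSr (linB (r_linear l0)) subrKA.
Qed.

Lemma kato_tail_cvg0 (lam : R) x : 0 < lam ->
  (fun N => kato lam (iter N (K lam) x)) @ \oo --> (0 : X).
Proof.
move=> l0; rewrite -(subrr (kato lam x)).
have h := telescope_resA x _ (kato_linear l0) (fun y => kato_resA y l0).
have c : (fun N => kato lam x - \sum_(0 <= n < N) r lam (iter n (K lam) x))
    @ \oo --> kato lam x - kato lam x.
  by apply: cvgB; [exact: cvg_cst|exact: kato_cvg].
by apply: (eq_cvgn _ c) => N; rewrite -h; module.
Qed.

Lemma resA_identity (lam mu : R) x : 0 < lam -> 0 < mu ->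
  r lam x = r mu (x + (mu - lam) *: r lam x).
Proof. exact: (resolvent_identity hX hU). Qed.

Lemma BresA_identity (lam mu : R) x : 0 < lam -> 0 < mu ->
  K lam x = K mu x + (mu - lam) *: K mu (r lam x).
Proof.
move=> l0 m0; rewrite -(linZ (BresA_linear m0)) -(linD (BresA_linear m0)).
by rewrite {2}/BresA -(resA_identity x l0 m0).
Qed.

(* With [s] the sum of the first [N] iterates and [z := s + (mu - lam) r_lam s]
   one has [r_mu z = r_lam s] and [K_mu z = K_lam s]. *)
Lemma kato_identity_partial (lam mu : R) x N (V : zmodType) (L : X -> V) :
    0 < lam -> 0 < mu -> {morph L : y z / y - z} ->
  let z := \sum_(0 <= n < N) iter n (K lam) x
    + (mu - lam) *: r lam (\sum_(0 <= n < N) iter n (K lam) x) in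
  L (x + (mu - lam) *: \sum_(0 <= n < N) r lam (iter n (K lam) x))
    = L (z - K mu z) + L (iter N (K lam) x).
Proof.
move=> l0 m0 hL z; set s := \sum_(_ <= _ < _) _ in z *.
have Kz : K mu z = K lam s.
  by rewrite (linD (BresA_linear m0)) (linZ (BresA_linear m0)) -BresA_identity.
have sS : s + iter N (K lam) x = x + K lam s.
  rewrite /s (lin_sum (BresA_linear l0)) -big_nat_recr//= big_nat_recl//.
have L0 : L 0 = 0 by have := hL 0 0; rewrite !subrr.
have hD y w : L (y + w) = L y + L w.
  by rewrite -[w in LHS]opprK hL -[- w]sub0r hL L0 sub0r opprK.
rewrite -hD Kz -(lin_sum (r_linear l0)) -/s; congr L.
have -> : iter N (K lam) x = x + K lam s - s by rewrite -sS; module.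
by rewrite /z; module.
Qed.

(** * Monotonicity in the spectral parameter *)

Section Monotonicity.
Context {lam mu : R} (l0 : 0 < lam) (lm : lam <= mu).

Let m0 : 0 < mu. Proof. exact: lt_le_trans lm. Qed.

Lemma resA_mono p : P p -> P (r lam p - r mu p).
Proof.
move=> Pp; rewrite (resA_identity p l0 m0) (linD (r_linear m0)) (linZ (r_linear m0)).
rewrite addrAC subrr add0r; apply: (cone_scale hX); first by rewrite subr_ge0.
by do 2!apply: r_cone =>//.
Qed.

Lemma BresA_mono p : P p -> P (K lam p - K mu p).
Proof.
move=> Pp; rewrite (BresA_identity p l0 m0) addrAC subrr add0r.
apply: (cone_scale hX); first by rewrite subr_ge0.
by apply: BresA_cone => //; exact: r_cone.
Qed.

Lemma iter_BresA_mono n p : P p -> P (iter n (K lam) p - iter n (K mu) p).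
Proof.
move=> Pp; elim: n => [|n IH]; first by rewrite subrr; exact: (cone0 hX).
rewrite !iterS -(subrKA (K mu (iter n (K lam) p))) -(linB (BresA_linear m0)).
apply: (cone_add hX); first exact/BresA_mono/K_cone.
exact: BresA_cone.
Qed.

Lemma kato_mono p : P p -> P (kato lam p - kato mu p).
Proof.
move=> Pp; apply: (cone_cvgB hX (@kato_cvg _ p l0) (@kato_cvg _ p m0)) => N.
rewrite -sumrB; apply: (cone_sum hX) => n _.
rewrite -(subrKA (r mu (iter n (K lam) p))) -(linB (r_linear m0)).
apply: (cone_add hX); first exact/resA_mono/K_cone.
exact/r_cone/iter_BresA_mono.
Qed.

End Monotonicity.

(** For equal parameters this is the remainder of the series. Otherwise, on the cone, monotonicity
    in the parameter dominates the sequence by such a remainder: enlarge [kato mu] if [lam <= mu],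
    and [K lam] if [mu <= lam]. *)
Lemma kato_iter_cvg0 (lam mu : R) x : 0 < lam -> 0 < mu ->
  (fun N => kato mu (iter N (K lam) x)) @ \oo --> (0 : X).
Proof.
move=> l0 m0.
suff H p : P p -> (fun N => kato mu (iter N (K lam) p)) @ \oo --> (0 : X).
  have [p [q [Pp Pq ->]]] := cone_generating hX x.
  have c := cvgnB (H _ Pp) (H _ Pq); rewrite subr0 in c.
  apply: (eq_cvgn _ c) => N; have [Kl _ _] := K_iter N l0.
  by rewrite (linB Kl) (linB (kato_linear m0)).
move=> Pp; have [_ kato_cone _] := pos_op_kato m0.
have [y [y0 yle]] : exists y : X ^nat, y @ \oo --> (0 : X) /\
    forall N, `|kato mu (iter N (K lam) p)| <= `|y N|.
  have [lm|/ltW ml] := leP lam mu.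
    exists (fun N => kato lam (iter N (K lam) p)); split; first exact: kato_tail_cvg0.
    move=> N; apply: (cone_norm_le hX); first exact/kato_cone/K_cone.
    exact/kato_mono/K_cone.
  exists (fun N => kato mu (iter N (K mu) p)); split; first exact: kato_tail_cvg0.
  move=> N; apply: (cone_norm_le hX); first exact/kato_cone/K_cone.
  rewrite -(linB (kato_linear m0)); apply/kato_cone.
  exact: iter_BresA_mono.
apply/cvgn_distP => e /((cvgn_distP _ _).1 y0)[N hN]; exists N => n /hN.
by rewrite !subr0; exact/le_trans.
Qed.

(** Limit of [kato_identity_partial] for [L := kato mu]: the first term becomes a partial sum of the
    series at [lam], and the second one vanishes. *)
Lemma kato_identity (lam mu : R) x : 0 < lam -> 0 < mu ->
  kato lam x = kato mu (x + (mu - lam) *: kato lam x).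
Proof.
move=> l0 m0; pose w N := x + (mu - lam) *: \sum_(0 <= n < N) r lam (iter n (K lam) x).
have cw : w @ \oo --> x + (mu - lam) *: kato lam x.
  by apply: cvgD; [exact: cvg_cst|apply: cvgZr; exact: kato_cvg].
apply: cvgn_unique (pos_op_cvg hX (pos_op_kato m0) cw).
have c := cvgnD (@kato_cvg _ x l0) (kato_iter_cvg0 x l0 m0); rewrite addr0 in c.
apply: (eq_cvgn _ c) => N /=; rewrite /w kato_identity_partial//; last first.
  by move=> y z; rewrite (linB (kato_linear m0)).
rewrite kato_resA// -(lin_sum (r_linear l0)) -(resA_identity _ l0 m0).
by [].
Qed.

Lemma kato_dense (lam : R) x (e : R) : 0 < lam -> 0 < e ->
  exists y, `|kato lam y - x| <= e.
Proof.
move=> l0 /(resolvent_dense hX hU l0 x)[y hy].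
by exists (y - K lam y); rewrite kato_resA.
Qed.

(** * The semigroup of Kato's series and its identification with the minimal one *)

Let W := euler_semigroup kato.

Lemma resolvent_kato (lam : R) : 0 < lam -> resolvent (gen_dom W) (gen W) lam = kato lam.
Proof.
exact: (resolvent_euler hX pos_op_kato kato_identity (fun x e => kato_dense x ltr01)).
Qed.

Lemma substochastic_kato : substochastic P W.
Proof.
exact: (substochastic_euler hX pos_op_kato kato_identity (fun x e => kato_dense x ltr01)).
Qed.

(** It suffices to compare resolvents at the single point 1: writing [v = r 1 y], the operator
    [1 - A - B] sends [v] to [y - K 1 y], which [kato 1] sends back to [v]. *)
Lemma kato_extension : substochastic_extension P U B W.
Proof.
have hW := substochastic_kato; split=>//.
have h v : gen_dom U v -> gen_dom W v /\ 1 *: v - gen W v = 1 *: v - perturbation U B v.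
  move=> Dv; apply/(gen_resolvent hX hW) => //; rewrite resolvent_kato//.
  have vE := resolvent_genE hX hU ltr01 Dv; set y := _ - _ in vE.
  have -> : 1 *: v - perturbation U B v = y - K 1 y.
    by have := perturbation_resA y ltr01; rewrite /resA vE => ->; rewrite subKr.
  by rewrite kato_resA.
split=> [v /h[]//|v /h[_ /addrI/oppr_inj]//].
Qed.

(** Two inequalities on the cone: the partial sums of the series lie below [resG V lam p], the
    remainder being positive, and minimality against [W] gives the converse. *)
Lemma resG_kato V (lam : R) : minimal_semigroup P U B V -> 0 < lam ->
  resG V lam = kato lam.
Proof.
move=> [[hV [DV genV]] minV] l0.
have Gl : linear (resG V lam) by exact: (resolvent_linear hX hV l0).
have Gr y : resG V lam (y - K lam y) = r lam y.
  apply/esym/(gen_resolvent hX hV) => //; split; first exact/DV/r_dom.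
  by rewrite genV ?perturbation_resA//; [module|exact: r_dom].
suff H p : P p -> resG V lam p = kato lam p.
  apply/funext => x; have [p [q [Pp Pq ->]]] := cone_generating hX x.
  by rewrite (linB Gl) (linB (kato_linear l0)) !H.
move=> Pp; apply/eqP; rewrite -subr_eq0; apply/eqP; apply: (cone_pointed hX).
  apply: (cone_cvgB hX (cvg_cst (resG V lam p)) (@kato_cvg _ p l0)) => N.
  rewrite -(telescope_resA p N Gl Gr) opprB subrKC.
  have [_ Gc _] := pos_op_resolvent hX hV l0.
  exact/Gc/K_cone.
rewrite opprB -resolvent_kato//.
apply: (resolvent_mono hX hV substochastic_kato) => // t q t0 Pq.
exact: (minV _ kato_extension).
Qed.

(** * The limiting mass along the orbits *)

Let Psi_continuous : continuous Psi := norm_functional_continuous hPsi.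

Let PsiD x y : Psi (x + y) = Psi x + Psi y. Proof. exact: linearD. Qed.

Let PsiB x y : Psi (x - y) = Psi x - Psi y. Proof. exact: linearB. Qed.

Let PsiZ a x : Psi (a *: x) = a * Psi x. Proof. exact: linearZ. Qed.

Lemma norm_functional_bounded : exists2 M : R, 0 < M &
  forall x, `|Psi x| <= M * `|x|.
Proof.
have [M M0 hM] := generating_const hX; exists M => // x.
have [p [q [Pp Pq xpq npq]]] := hM x.
by rewrite {1}xpq PsiB !PsiE// (le_trans (ler_normB _ _))// !normr_id.
Qed.

Definition flux (lam : R) (x : X) : R := limn (fun n => Psi (iter n (K lam) x)).

Lemma flux_cone_cvg (lam : R) p : 0 < lam -> P p ->
  (fun n => `|iter n (K lam) p|) @ \oo --> flux lam p.
Proof.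
move=> l0 Pp.
have e n : Psi (iter n (K lam) p) = `|iter n (K lam) p| by apply/PsiE/K_cone.
rewrite /flux (funext e); apply: nonincreasing_is_cvgn; last first.
  by exists 0 => _ [n _ <-].
apply/nonincreasing_seqP => n; rewrite iterS.
by have [_ _ /(_ _ (K_cone n l0 Pp))] := pos_op_BresA l0; rewrite mul1r.
Qed.

Lemma flux_cvg (lam : R) x : 0 < lam ->
  (fun n => Psi (iter n (K lam) x)) @ \oo --> flux lam x.
Proof.
move=> l0; suff : cvgn (fun n => Psi (iter n (K lam) x)) by [].
have [p [q [Pp Pq ->]]] := cone_generating hX x.
apply/cvg_ex; exists (flux lam p - flux lam q).
apply: (eq_cvgn _ (cvgnB (flux_cone_cvg l0 Pp) (flux_cone_cvg l0 Pq))) => n.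
have [Kl _ _] := K_iter n l0.
by rewrite (linB Kl) PsiB !PsiE//; exact: K_cone.
Qed.

Lemma fluxB (lam : R) x y : 0 < lam -> flux lam (x - y) = flux lam x - flux lam y.
Proof.
move=> l0; apply: (cvgn_unique (@flux_cvg lam (x - y) l0)).
apply: (eq_cvgn _ (cvgnB (@flux_cvg lam x l0) (@flux_cvg lam y l0))) => n.
by have [Kl _ _] := K_iter n l0; rewrite (linB Kl) PsiB.
Qed.

Lemma flux_BresA (lam : R) x : 0 < lam -> flux lam (K lam x) = flux lam x.
Proof.
move=> l0; apply: (cvgn_unique (@flux_cvg lam (K lam x) l0)).
have := @flux_cvg lam x l0; rewrite -(cvg_shiftS (fun n => Psi (iter n (K lam) x))).
by apply: eq_cvgn => n; rewrite -iterSr.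
Qed.

Lemma flux_iter (lam : R) N x : 0 < lam ->
  flux lam (iter N (K lam) x) = flux lam x.
Proof. by move=> l0; elim: N => //= N IH; rewrite flux_BresA. Qed.

Lemma flux_bounded (lam : R) : 0 < lam -> exists2 M : R, 0 < M &
  forall x, `|flux lam x| <= M * `|x|.
Proof.
move=> l0; have [M M0 hM] := norm_functional_bounded.
have [N N0 hN] := pos_op_bounded hX.
exists (M * N) => [|x]; first exact: mulr_gt0.
apply: (cvgn_norm_le (@flux_cvg lam x l0)) => n.
rewrite (le_trans (hM _))// -mulrA ler_wpM2l ?(ltW M0)//.
by have := hN _ _ ler01 (K_iter n l0) x; rewrite mulr1.
Qed.

Lemma flux_continuous (lam : R) (y : X ^nat) x : 0 < lam -> y @ \oo --> x ->
  (fun n => flux lam (y n)) @ \oo --> flux lam x.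
Proof.
move=> l0 /cvgn_distP yx; have [M M0 hM] := flux_bounded l0.
apply/cvgn_distP => e e0; have /yx[N hN] : 0 < e / M by rewrite divr_gt0.
exists N => n /hN h; rewrite -fluxB// (le_trans (hM _))//.
by rewrite mulrC -ler_pdivlMr.
Qed.

(** Replace the factors [K lam] by [K mu] one at a time; by [BresA_identity] and contractivity on
    the cone, each exchange costs one term of the sum. *)
Lemma iter_BresA_dist (lam mu : R) n p : 0 < lam -> 0 < mu -> P p ->
  `|iter n (K lam) p - iter n (K mu) p|
    <= `|mu - lam| * `|\sum_(0 <= k < n) r lam (iter k (K lam) p)|.
Proof.
move=> l0 m0 Pp; rewrite (cone_norm_sum hX) => [|k]; last exact/r_cone/K_cone.
elim: n p Pp => [|n IH] p Pp; first by rewrite subrr normr0 big_nil mulr0.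
rewrite !iterSr -(subrKA (iter n (K mu) (K lam p))) (le_trans (ler_normD _ _))//.
rewrite big_nat_recl// mulrDr addrC lerD//; last first.
  rewrite (le_trans (IH _ (BresA_cone l0 Pp)))// ler_wpM2l//.
  by apply: ler_sum => k _; rewrite -iterSr.
have [Kl _ Kn] := K_iter n m0.
rewrite -(linB Kl) (BresA_identity p l0 m0) addrAC subrr add0r (linZ Kl) normrZ.
rewrite ler_wpM2l// -iterSr.
have [_ _ /(_ _ (r_cone l0 Pp))] := K_iter n.+1 m0.
by rewrite mul1r.
Qed.

(** Both fluxes are compared at [K^N p], where [flux lam] keeps its value at [p]; by
    [iter_BresA_dist] they differ by at most a multiple of the remainder of Kato's series. *)
Lemma flux_iter_cvg (lam mu : R) x : 0 < lam -> 0 < mu ->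
  (fun N => flux mu (iter N (K lam) x)) @ \oo --> flux lam x.
Proof.
move=> l0 m0.
suff H p : P p -> (fun N => flux mu (iter N (K lam) p)) @ \oo --> flux lam p.
  have [p [q [Pp Pq ->]]] := cone_generating hX x; rewrite fluxB//.
  apply: (eq_cvgn _ (cvgnB (H _ Pp) (H _ Pq))) => N; have [Kl _ _] := K_iter N l0.
  by rewrite (linB Kl) fluxB.
move=> Pp.
have le N : `|flux mu (iter N (K lam) p) - flux lam p|
    <= `|mu - lam| * `|kato lam (iter N (K lam) p)|.
  rewrite -(flux_iter N p l0) distrC; set q := iter N _ p.
  have Pq : P q by exact: K_cone.
  apply: (cvgn_norm_le (cvgnB (flux_cone_cvg l0 Pq) (flux_cone_cvg m0 Pq))) => j.
  rewrite (le_trans (ler_dist_dist _ _))//.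
  rewrite (le_trans (iter_BresA_dist _ l0 m0 Pq))// ler_wpM2l//.
  apply: (cone_norm_le hX).
    by apply: (cone_sum hX) => k _; exact/r_cone/K_cone.
  rewrite -(telescope_resA q j (kato_linear l0) (fun y => kato_resA y l0)).
  rewrite opprB subrKC; have [_ kc _] := pos_op_kato l0; exact/kc/K_cone.
apply/cvgn_distP => e e0.
have c0 : 0 < `|mu - lam| + 1 by rewrite ltr_wpDl.
have /((cvgn_distP _ _).1 (kato_tail_cvg0 p l0))[N hN] : 0 < e / (`|mu - lam| + 1).
  by rewrite divr_gt0.
exists N => n /hN; rewrite subr0 ler_pdivlMr// mulrC => h.
rewrite (le_trans (le n))// (le_trans _ h)// ler_wpM2r// lerDl//.
Qed.

(** As for [kato_identity], now with [L := flux mu], which vanishes on the range of [1 - K mu]: only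
    the remainder survives. This is what makes [fun_abar] independent of the parameter. *)
Lemma flux_identity (lam mu : R) x : 0 < lam -> 0 < mu ->
  flux mu (x + (mu - lam) *: kato lam x) = flux lam x.
Proof.
move=> l0 m0; pose w N := x + (mu - lam) *: \sum_(0 <= n < N) r lam (iter n (K lam) x).
have cw : w @ \oo --> x + (mu - lam) *: kato lam x.
  by apply: cvgD; [exact: cvg_cst|apply: cvgZr; exact: kato_cvg].
apply: (cvgn_unique (flux_continuous m0 cw)).
apply: (eq_cvgn _ (@flux_iter_cvg lam mu x l0 m0)) => N; rewrite /w.
rewrite (kato_identity_partial _ _ l0 m0); last by move=> y z; exact: fluxB.
by rewrite fluxB// flux_BresA// subrr add0r.
Qed.

Lemma fun_a_resA (lam : R) x : 0 < lam ->
  fun_a Psi U B (r lam x) = Psi x - Psi (K lam x) - lam * Psi (r lam x).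
Proof. by move=> l0; rewrite /fun_a perturbation_resA// !PsiB PsiZ; ring. Qed.

Lemma fun_a_series_cvg (lam : R) x : 0 < lam ->
  series (fun n => fun_a Psi U B (r lam (iter n (K lam) x))) @ \oo -->
  Psi x - lam * Psi (kato lam x) - flux lam x.
Proof.
move=> l0; have Pk : (fun N => Psi (\sum_(0 <= n < N) r lam (iter n (K lam) x))) @ \oo
    --> Psi (kato lam x).
  by apply: (cvg_comp _ _ (@kato_cvg lam x l0)); exact: Psi_continuous.
have c : (fun N => Psi x - lam * Psi (\sum_(0 <= n < N) r lam (iter n (K lam) x))
    - Psi (iter N (K lam) x)) @ \oo --> Psi x - lam * Psi (kato lam x) - flux lam x.
  apply: cvgnB; last exact: flux_cvg.
  by apply: cvgnB; [exact: cvg_cst|exact: cvgMr].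
apply: (eq_cvgn _ c) => N; rewrite seriesEnat /=.
elim: N => [|N IH]; first by rewrite !big_nil linear0 mulr0 subr0 subrr.
by rewrite !big_nat_recr//= IH fun_a_resA// PsiD; ring.
Qed.

(** * The functionals of the minimal semigroup and the four assertions *)

Section Minimal.
Context {V : R -> X -> X}.
Hypothesis hV : minimal_semigroup P U B V.

Let hV1 : substochastic P V := hV.1.1.

Lemma resG_linear (lam : R) : 0 < lam -> linear (resG V lam).
Proof. by move=> l0; rewrite resG_kato//; exact: kato_linear. Qed.

Lemma gen_resG (lam : R) x : 0 < lam ->
  gen V (resG V lam x) = lam *: resG V lam x - x.
Proof. exact: (gen_resolventE hX hV1). Qed.

Lemma fun_abar_resG (lam : R) x : 0 < lam ->
  fun_abar Psi U B V (resG V lam x) = Psi x - lam * Psi (resG V lam x) - flux lam x.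
Proof.
move=> l0; apply: xget_unique => [mu y m0 vE|s hs].
  rewrite (_ : Psi x - _ - _ = Psi y - mu * Psi (kato mu y) - flux mu y).
    exact: fun_a_series_cvg.
  (* Both [x] and [y] are determined by the common vector [v], being [lam *: v - gen V v] and
     [mu *: v - gen V v]. *)
  have yE : y = x + (mu - lam) *: resG V lam x.
    have := gen_resG x l0; rewrite -vE gen_resG// vE => e.
    have -> : y = mu *: resG V lam x - (mu *: resG V lam x - y) by module.
    by rewrite e; module.
  rewrite -(resG_kato hV m0) vE {2}yE (resG_kato hV l0) flux_identity//.
  by rewrite {1}yE PsiD PsiZ (resG_kato hV l0); ring.
rewrite (resG_kato hV l0).
exact: (cvgn_unique (hs lam x l0 erefl) (@fun_a_series_cvg lam x l0)).
Qed.

Lemma XiE (lam : R) x : 0 < lam -> Xi Psi U B V lam x = flux lam x.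
Proof.
move=> l0; rewrite /Xi fun_abar_resG// /fun_a0 gen_resG// PsiB PsiZ.
by ring.
Qed.

Lemma resG_perturbation (lam : R) v : 0 < lam -> gen_dom U v ->
  resG V lam (lam *: v - perturbation U B v) = v /\
  flux lam (lam *: v - perturbation U B v) = 0.
Proof.
move=> l0 Dv; have := resolvent_genE hX hU l0 Dv; set y := _ - _ => vE.
have -> : lam *: v - perturbation U B v = y - K lam y.
  by have := perturbation_resA y l0; rewrite /resA vE => ->; rewrite subKr.
by rewrite resG_kato// kato_resA// fluxB// flux_BresA// subrr.
Qed.

Lemma closure_dom_flux (lam : R) x : 0 < lam ->
  closure_dom (gen_dom U) (perturbation U B) (resG V lam x) -> flux lam x = 0.
Proof.
move=> l0 [g clg]; set v := resG V lam x in clg.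
have near (e : R) : 0 < e -> exists phi,
    [/\ gen_dom U phi, `|v - phi| <= e & `|g - perturbation U B phi| <= e].
  move=> e0; have := clg [set vg | `|v - vg.1| <= e /\ `|g - vg.2| <= e].
  case=> [|[_ _] [[phi Dphi [<- <-]] [h1 h2]]]; last by exists phi.
  exists (ball v e, ball g e) => [|[y z] /= []]; first by split; exact: nbhsx_ballx.
  by rewrite -!ball_normE /= => /ltW ? /ltW.
have [M M0 hM] := flux_bounded l0.
have [C C0 hC] := pos_op_bounded hX.
have l1 : 0 < lam + 1 by rewrite addr_gt0.
pose z phi := lam *: v - g - (lam *: phi - perturbation U B phi).
have zle (e : R) phi : `|v - phi| <= e -> `|g - perturbation U B phi| <= e ->
    `|z phi| <= (lam + 1) * e.
  move=> h1 h2.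
  have -> : z phi = lam *: (v - phi) - (g - perturbation U B phi) by rewrite /z; module.
  rewrite (le_trans (ler_normB _ _))// normrZ gtr0_norm// mulrDl mul1r lerD//.
  by rewrite ler_wpM2l// ltW.
(* Closedness of the generator of [V]: the images of [phi] under [lam - A - B] tend to
   [lam *: v - g], and the bounded operator [resG V lam] sends them back to [phi]. *)
have vg : v = resG V lam (lam *: v - g).
  apply/eqP; rewrite -subr_eq0 -normr_le0; apply/ler_addgt0Pl => e e0; rewrite addr0.
  pose c := 1 + C * lam^-1 * (lam + 1).
  have c0 : 0 < c by rewrite ltr_pwDl// !mulr_ge0 ?invr_ge0// ltW.
  have [phi [Dphi h1 h2]] := near _ (divr_gt0 e0 c0).
  have [Rphi _] := resG_perturbation l0 Dphi.
  have -> : v - resG V lam (lam *: v - g) = (v - phi) - resG V lam (z phi).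
    have -> : resG V lam (z phi) = resG V lam (lam *: v - g) - phi.
      by rewrite /z (linB (resG_linear l0)) Rphi.
    by module.
  rewrite (le_trans (ler_normB _ _))//.
  have linv : 0 <= lam^-1 by rewrite invr_ge0 ltW.
  have -> : e = e / c + C * lam^-1 * ((lam + 1) * (e / c)).
    by rewrite mulrA -[X in X + _]mul1r -mulrDl -/c mulrC divfK ?gt_eqF.
  apply: lerD => //; apply: (le_trans (hC _ _ linv (pos_op_resolvent hX hV1 l0) (z phi))).
  by rewrite ler_wpM2l ?mulr_ge0 ?(ltW C0)// zle.
(* The resolvent is injective: [gen V v] can be computed from either preimage of [v]. *)
have xE : x = lam *: v - g.
  have := gen_resG x l0; rewrite -/v vg gen_resG// -vg => /addrI/oppr_inj ->.
  by [].
apply/eqP; rewrite -normr_le0; apply/ler_addgt0Pl => e e0; rewrite addr0.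
have c0 : 0 < M * (lam + 1) by rewrite mulr_gt0.
have [phi [Dphi h1 h2]] := near _ (divr_gt0 e0 c0).
have [_ fphi] := resG_perturbation l0 Dphi.
have -> : flux lam x = flux lam (z phi) by rewrite /z fluxB// fphi subr0 -xE.
rewrite (le_trans (hM _))// -ler_pdivlMl// (le_trans (zle _ _ h1 h2))//.
rewrite le_eqVlt; apply/predU1P; left; field.
by rewrite !gt_eqF.
Qed.

Lemma flux_closure_dom (lam : R) p : 0 < lam -> P p -> flux lam p = 0 ->
  closure_dom (gen_dom U) (perturbation U B) (resG V lam p).
Proof.
move=> l0 Pp f0; have := flux_cone_cvg l0 Pp; rewrite f0 => /cvgn_distP K0.
have c1 : (fun N => r lam (\sum_(0 <= n < N) iter n (K lam) p)) @ \oo --> resG V lam p.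
  rewrite resG_kato//; apply: (eq_cvgn _ (@kato_cvg lam p l0)) => N.
  by rewrite (lin_sum (r_linear l0)).
have c2 : (fun N => iter N (K lam) p) @ \oo --> (0 : X).
  apply/cvgn_distP => e /K0[N hN]; exists N => n /hN.
  by rewrite !subr0 ger0_norm.
exists (lam *: resG V lam p - p).
(* The sum [s] of the first [N] iterates satisfies [s - K s = p - K^N p], so the images converge as
   soon as [K^N p] tends to 0. *)
have c3 : (fun N => perturbation U B (r lam (\sum_(0 <= n < N) iter n (K lam) p)))
    @ \oo --> lam *: resG V lam p - p.
  have c1' : (fun N => lam *: r lam (\sum_(0 <= n < N) iter n (K lam) p)) @ \oo
      --> lam *: resG V lam p by exact: cvgZr.
  have cp : (fun=> p) @ \oo --> p by exact: cvg_cst.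
  have c := cvgnB c1' (cvgnB cp c2).
  rewrite subr0 in c; apply: (eq_cvgn _ c) => N; rewrite perturbation_resA//.
  congr (_ - _); elim: N {c} => [|N IH].
    by rewrite big_nil (lin0 (BresA_linear l0)) !subrr.
  rewrite big_nat_recr//= (linD (BresA_linear l0)).
  rewrite opprD addrACA IH; module.
move=> A /(cvg_pair c1 c3)[N _ /(_ N (leqnn N)) AN].
eexists; split; last exact: AN.
by eexists; last reflexivity; exact: r_dom.
Qed.

Lemma weakly_compact_flux (lam : R) p : 0 < lam -> P p ->
  relatively_weakly_compact (range (fun n => iter n (K lam) p)) ->
  flux lam p = 0.
Proof.
move=> l0 Pp /weak_cluster_value[z hz].
rewrite -(hz Psi _ Psi_continuous (@flux_cvg lam p l0)).
(* It is unknown whether [Psi z] itself can be read off the orbit as 0, so [z] is approximated by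
   the vectors [mu *: r mu z] with [mu = n.+1], on which [Psi] vanishes. *)
have c := @resolvent_approx _ _ _ hX _ r_pos resA_identity
  (resolvent_dense hX hU ltr01) z.
have cP : (fun n => Psi (n.+1%:R *: r n.+1%:R z)) @ \oo --> Psi z.
  by apply: (cvg_comp _ _ c); exact: Psi_continuous.
apply: (cvgn_unique cP); apply: (eq_cvgn _ (cvg_cst 0)) => n.
have n0 : 0 < n.+1%:R :> R by [].
have rl := r_linear n0.
have fl : linear (Psi \o r n.+1%:R : X -> R^o).
  by move=> a x y; rewrite /= rl PsiD PsiZ.
pose f : {linear X -> R^o} := HB.pack (Psi \o r n.+1%:R : X -> R^o)
  (GRing.isLinear.Build _ _ _ _ _ fl).
have rc := pos_op_continuous hX (r_pos n0).
have cf : continuous f.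
  by move=> x; apply: continuous_comp; [exact: rc|exact: Psi_continuous].
suff cK : f (iter m (K lam) p) @[m --> \oo] --> (0 : R).
  by rewrite PsiZ -[Psi (r _ z)]/(f z) (hz f 0 cf cK) mulr0.
(* The orbit tends to 0 under [r lam], as general term of Kato's series; the resolvent identity
   carries this over to the parameter [n.+1]. *)
have c1 : (fun m => r n.+1%:R (iter m (K lam) p)) @ \oo --> (0 : X).
  have c2 : (fun m => (n.+1%:R - lam) *: r n.+1%:R (r lam (iter m (K lam) p))) @ \oo
      --> (n.+1%:R - lam) *: r n.+1%:R 0.
    by apply: cvgZr; exact: (pos_op_cvg hX (r_pos n0) (resA_iter_cvg0 p l0)).
  have c3 := cvgnB (resA_iter_cvg0 p l0) c2; rewrite (lin0 rl) scaler0 subr0 in c3.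
  apply: (eq_cvgn _ c3) => m; set y := iter m _ p.
  by rewrite {1}(resA_identity y l0 n0) (linD rl) (linZ rl) addrK.
rewrite -(linear0 Psi).
by apply: (cvg_comp _ _ c1); exact: Psi_continuous.
Qed.

End Minimal.

End Kato.

Theorem theorem3p5 (R : realType) (X : completeNormedModType R)
    (P : set X) (Psi : {linear X -> R^o})
    (U : R -> X -> X) (B : X -> X) (V : R -> X -> X) (lam : R) (u : X)
    (hX : abstract_state_space P)
    (hPsi : norm_functional P Psi)
    (hU : substochastic P U)
    (hBlin : linear_on (gen_dom U) B)
    (hBpos : positive_on P (gen_dom U) B)
    (hAB : forall v, gen_dom U v -> P v -> Psi (perturbation U B v) <= (0 : R))
    (hV : minimal_semigroup P U B V)
    (hlam : 0 < lam)
    (hu : P u) :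
  [<-> relatively_weakly_compact (range (fun n => iter n (BresA U B lam) u));
       (fun n => `|iter n (BresA U B lam) u|) @ \oo --> (0 : R);
       Xi Psi U B V lam u = 0;
       closure_dom (gen_dom U) (perturbation U B) (resG V lam u)].
Proof.
have fcv := flux_cone_cvg hX hPsi hU hBlin hBpos hAB hlam hu.
have xi := XiE hX hPsi hU hBlin hBpos hAB hV u hlam.
tfae.
- move=> wc.
  by rewrite -(weakly_compact_flux hX hPsi hU hBlin hBpos hAB hlam hu wc).
- by move=> /(cvgn_unique fcv); rewrite xi.
- by rewrite xi; exact: (flux_closure_dom hX hPsi hU hBlin hBpos hAB hV hlam hu).
(* The cycle closes through norm convergence: zero flux makes the orbit tend to 0, and a convergent
   sequence is relatively weakly compact. *)
- move=> cl; apply: (cvg_relatively_weakly_compact (l := 0)).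
  have f0 := closure_dom_flux hX hPsi hU hBlin hBpos hAB hV hlam cl.
  rewrite f0 in fcv; apply/cvgn_distP => e /((cvgn_distP _ _).1 fcv)[N hN].
  by exists N => n /hN; rewrite !subr0 ger0_norm.
Qed.
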